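(* Let $G$ be a finite-dimensional connected compact abelian group. Suppose that $G\cong_t T\times K$ and $G\cong_t T'\times K'$, where $T,T'$ are totally factored and $K,K'$ are clipped. Then $T\cong_t T'$ (topologically isomorphic) and $K$ and $K'$ are nearly isomorphic.
   Context: All groups are abelian; $\mathrm{cHom}(G,H)$ denotes continuous homomorphisms. The dimension of a compact group $G$ is $\dim_\mathbb{R}\mathrm{cHom}(\mathbb{R},G)$. A solenoid is a connected compact group of dimension $1$. A connected compact group is totally factored if it is topologically isomorphic to a product of solenoids (trivial group allowed). A compact group is clipped if it is not topologically isomorphic to $\Sigma\times L$ for any solenoid $\Sigma$ and topological group $L$. Two compact groups $G,H$ are nearly isomorphic if for every prime $p$ there exist $\varphi\in\mathrm{cHom}(G,H)$, $\psi\in\mathrm{cHom}(H,G)$ and an integer $n$ with $\gcd(p,n)=1$ such that $\varphi\psi=n1_H$ and $\psi\varphi=n1_G$. *)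

(* Defs.v *)
From HB Require Import structures.
From mathcomp Require Import all_boot all_order all_algebra.
From mathcomp Require Import all_classical all_reals all_analysis.
From mathcomp Require Import Rstruct Rstruct_topology.
Local Notation R := Rdefinitions.R.

Set Implicit Arguments.
Unset Strict Implicit.
Unset Printing Implicit Defensive.

Import Order.TTheory GRing.Theory Num.Theory.
Local Open Scope classical_set_scope.
Local Open Scope ring_scope.

(** Abelian groups carrying a topology (no continuity assumed): used for the
    carriers of products such as T * K, which get the product group structure
    and the product topology. *)
Notation topZmod := PreTopologicalZmodule.type.

(* Product group structure + product topology on pairs, as a topZmod. *)
HB.saturate prod.

Definition is_chom {A B : topZmod} (f : A -> B) : Prop :=
  (forall x y, f (x + y) = f x + f y) /\ continuous f.

Definition top_iso (A B : topZmod) : Prop :=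
  exists (f : A -> B) (g : B -> A),
    is_chom f /\ is_chom g /\ cancel f g /\ cancel g f.

Definition compact_group (G : topologicalZmodType) : Prop :=
  compact [set: G] /\ hausdorff_space G.

Definition connected_compact_group (G : topologicalZmodType) : Prop :=
  compact_group G /\ connected [set: G].

(** The real vector space cHom(R,G), with (r.f)(t) = f (r t) and pointwise
    addition.  [dim_eq G n] : cHom(R,G) has real dimension n, i.e. it has a
    basis b_0,...,b_{n-1}: every f in cHom(R,G) is uniquely
    f = sum_i c_i . b_i. *)
Definition dim_eq (G : topologicalZmodType) (n : nat) : Prop :=
  exists b : 'I_n -> (R^o -> G),
    (forall i, is_chom (b i)) /\
    (forall f : R^o -> G, is_chom f ->
       exists! c : 'I_n -> R, f = (fun t : R^o => \sum_(i < n) b i (c i * t))).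

Definition finite_dimensional (G : topologicalZmodType) : Prop :=
  exists n, dim_eq G n.

Definition solenoid (S : topologicalZmodType) : Prop :=
  connected_compact_group S /\ dim_eq S 1.

Definition totally_factored (T : topologicalZmodType) : Prop :=
  connected_compact_group T /\
  exists (I : Type) (S : I -> topologicalZmodType),
    (forall i, solenoid (S i)) /\
    exists (f : T -> prod_topology (fun i => (S i : topologicalType)))
           (g : prod_topology (fun i => (S i : topologicalType)) -> T),
      (forall x y i, f (x + y) i = f x i + f y i) /\
      continuous f /\ continuous g /\ cancel f g /\ cancel g f.

Definition clipped (K : topologicalZmodType) : Prop :=
  compact_group K /\
  ~ exists (S L : topologicalZmodType), solenoid S /\ top_iso K (S * L)%type.

Definition nearly_iso (G H : topologicalZmodType) : Prop :=
  forall p : nat, prime p ->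
    exists (phi : G -> H) (psi : H -> G) (n : int),
      is_chom phi /\ is_chom psi /\ coprime p `|n|%N /\
      (forall y : H, phi (psi y) = y *~ n) /\
      (forall x : G, psi (phi x) = x *~ n).

(* Main.v *)
Require Import Defs.
From HB Require Import structures.
From mathcomp Require Import all_boot all_order all_algebra.
From mathcomp Require Import all_classical all_reals all_analysis.
From mathcomp Require Import Rstruct Rstruct_topology.
From mathcomp Require Import complex.
From mathcomp Require Import ring lra zify.

(* A solenoid S has a dual of rank one, so End S is a subring of Q.  Given
   T x K near to T' x K' and a solenoid factor S of T, the identity times n_p
   (p not dividing n_p) factors through T' x K' for every prime p; if S were
   isomorphic to no factor of T', all these factorizations would go through K',
   and a Bezout argument in End S would produce a factorization of the identity
   itself, making S a direct factor of the clipped group K'.  So some factor of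
   T' is isomorphic to S, and it can be cancelled prime by prime because End S
   localized at p is a local ring.

   The facts about solenoids rest on two theorems on compact abelian groups
   proved by means of an invariant mean M.  Characters separate points: among
   positive definite functions phi with phi 0 = 1 that maximize a linear
   functional M (f0 * phi), one maximizing M (phi ^+ 2) is an extreme point and
   so solves d'Alembert's equation, i.e. is the real part of a character.
   Kronecker: a homomorphism from the dual to the circle is an evaluation
   (Bohr's argument with powers of (1 + omega) / 2), which yields one-parameter
   subgroups and divisibility. *)

Set Implicit Arguments.
Unset Strict Implicit.
Unset Printing Implicit Defensive.

Import Order.TTheory GRing.Theory Num.Theory.
Import numFieldNormedType.Exports.
Local Open Scope classical_set_scope.
Local Open Scope ring_scope.

(** * Invariant means *)

(** Cancelling a direct factor requires a local endomorphism ring, and a subring of the rationals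
    becomes local only after localizing at a prime; this is why [K] and [K'] are compared up to near
    isomorphism. The induction over the factors therefore assumes only [nearly_iso], although it
    starts from an isomorphism. The solenoids themselves are matched up to isomorphism, because in
    rank one maps in both directions with nonzero composite already force one; hence [T] and [T']
    come out isomorphic. Finite dimension makes both families of solenoids finite. Dimension is
    defined through one-parameter subgroups, while the arguments on solenoids need the rank of the
    dual. The bridge: every homomorphism from the dual to the reals comes from a one-parameter
    subgroup, so independent characters would give non-proportional subgroups. A mean obtained as a
    limit of finite averages suffices for all this: only linearity, positivity, normalization and
    invariance enter, never countable additivity. *)

Section Averages.
Context {R : realType} {G : zmodType}.
Implicit Types (f g : G -> R) (s t e : seq G).

Definition bounded f := exists B : R, forall x, `|f x| <= B.

Lemma bounded_add f g : bounded f -> bounded g -> bounded (fun x => f x + g x).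
Proof.
move=> [B fB] [C gC]; exists (B + C) => x.
by rewrite (le_trans (ler_normD _ _))// lerD.
Qed.

Lemma bounded_mul f g : bounded f -> bounded g -> bounded (fun x => f x * g x).
Proof.
move=> [B fB] [C gC]; exists (B * C) => x.
by rewrite normrM ler_pM.
Qed.

Lemma bounded_cst (c : R) : bounded (fun=> c).
Proof. by exists `|c|. Qed.

Lemma bounded_comp f (h : G -> G) : bounded f -> bounded (fun x => f (h x)).
Proof. by move=> [B fB]; exists B => x. Qed.

Lemma bounded_scale f (c : R) : bounded f -> bounded (fun x => c * f x).
Proof. exact/bounded_mul/bounded_cst. Qed.

Lemma bounded_sub f g : bounded f -> bounded g -> bounded (fun x => f x - g x).
Proof.
move=> [B fB] [C gC]; exists (B + C) => x.
by rewrite (le_trans (ler_normB _ _))// lerD.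
Qed.

Definition avg s f : R := (\sum_(a <- s) f a) / (size s)%:R.

Lemma avgD s f g : avg s (fun x => f x + g x) = avg s f + avg s g.
Proof. by rewrite /avg big_split/= mulrDl. Qed.

Lemma avgZ s (c : R) f : avg s (fun x => c * f x) = c * avg s f.
Proof. by rewrite /avg -mulr_sumr mulrA. Qed.

Lemma avg_cst s (c : R) : s != [::] -> avg s (fun=> c) = c.
Proof.
move=> s0; rewrite /avg big_const_seq count_predT iter_addr_0 -[c *+ _]mulr_natr.
by rewrite mulfK// pnatr_eq0 size_eq0.
Qed.

Lemma ler_avg s f g : (forall x, f x <= g x) -> avg s f <= avg s g.
Proof.
move=> fg; rewrite /avg ler_wpM2r// ?invr_ge0 ?ler0n//.
by apply: ler_sum => i _; exact: fg.
Qed.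

Lemma norm_avg s f (B : R) : (forall x, `|f x| <= B) -> s != [::] ->
  `|avg s f| <= B.
Proof.
move=> fB s0; rewrite ler_norml; apply/andP; split.
  rewrite -(avg_cst (- B) s0); apply: ler_avg => x.
  by have := fB x; rewrite ler_norml => /andP[].
rewrite -[leRHS](avg_cst B s0); apply: ler_avg => x.
by have := fB x; rewrite ler_norml => /andP[].
Qed.

Lemma avg_exchange s t (F : G -> G -> R) :
  avg s (fun x => avg t (F x)) = avg t (fun y => avg s (F^~ y)).
Proof.
rewrite /avg -!mulr_suml exchange_big/= -!mulrA; congr (_ * _).
exact: mulrC.
Qed.

(* Averaging over [t] is averaging over a translate-average of [s]; this makes
   finite multisets a directed set along which averages converge. *)
Definition refines s : set (seq G) :=
  [set t | t != [::] /\ exists2 e, e != [::] &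
     forall f, avg t f = avg e (fun b => avg s (fun a => f (a + b)))].

Lemma avg_allpairs s e f : avg [seq a + b | a <- s, b <- e] f =
  avg e (fun b => avg s (fun a => f (a + b))).
Proof.
rewrite avg_exchange /avg big_allpairs_dep size_allpairs natrM invfM.
by rewrite -mulr_suml mulrCA mulrA [RHS]mulrC mulrA.
Qed.

Lemma allpairs_neq0 s e : s != [::] -> e != [::] ->
  [seq a + b | a <- s, b <- e] != [::].
Proof. by rewrite -!size_eq0 size_allpairs muln_eq0 => /negPf-> /negPf->. Qed.

(** The pairwise sums form a translate-average of [s] and also one of [t]; the second reading uses
    that [G] is commutative. *)
Lemma refinesI s t : s != [::] -> t != [::] ->
  refines [seq a + b | a <- s, b <- t] `<=` refines s `&` refines t.
Proof.
move=> s0 t0 u [u0 [e e0 ue]]; split; (split=> //).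
  exists [seq a + b | a <- t, b <- e]; first exact: allpairs_neq0.
  move=> f; rewrite ue avg_allpairs; congr avg; apply/funext => x.
  rewrite avg_allpairs; congr avg; apply/funext => y.
  by congr avg; apply/funext => z; rewrite addrA.
exists [seq a + b | a <- s, b <- e]; first exact: allpairs_neq0.
move=> f; rewrite ue avg_allpairs; congr avg; apply/funext => x.
rewrite avg_allpairs avg_exchange; congr avg; apply/funext => y.
by congr avg; apply/funext => z; rewrite addrA (addrC z).
Qed.

Definition refines_filter := filter_from [set s | s != [::]] refines.

Lemma refines_proper : ProperFilter refines_filter.
Proof.
apply: filter_from_proper.
  apply: filter_from_filter; first by exists [:: 0].
  move=> s t s0 t0; exists [seq a + b | a <- s, b <- t].
    exact: allpairs_neq0.
  exact: refinesI.
move=> s s0; exists s; split=> //; exists [:: 0] => // f.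
rewrite /avg big_seq1/= divr1; congr (_ / _).
by apply: eq_bigr => i _; rewrite addr0.
Qed.

End Averages.

Section Mean.
Context {R : realType} {G : zmodType}.

(* [M f] is meaningless for unbounded [f]. *)
Record is_mean (M : (G -> R) -> R) : Prop := IsMean {
  meanD : forall f g, bounded f -> bounded g ->
    M (fun x => f x + g x) = M f + M g;
  meanZ : forall c f, bounded f -> M (fun x => c * f x) = c * M f;
  mean_ge0 : forall f, bounded f -> (forall x, 0 <= f x) -> 0 <= M f;
  mean_cst : forall c, M (fun=> c) = c;
  mean_shift : forall f a, bounded f -> M (fun x => f (x + a)) = M f }.

Lemma ultra_bounded_cvg (T : Type) (U : set_system T) (h : T -> R) (B : R) :
  UltraFilter U -> (\forall t \near U, `|h t| <= B) -> cvg (h @ U).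
Proof.
move=> UU hB.
have hUp : ProperFilter (h @ U) by exact: fmap_proper_filter.
have cI : compact `[- B, B] by exact: segment_compact.
have [|p [_ clp]] := cI (h @ U) hUp.
  near=> t; rewrite /= in_itv/= -ler_norml; near: t; exact: hB.
apply/cvg_ex; exists p => V pV.
have [//|UV] := in_ultra_setVsetC (h @^-1` V) UU.
by have [z []] := clp (~` V) V UV pV.
Unshelve. all: by end_near. Qed.

(* Invariance under [a]: along refinements of {0, a, ..., (n-1)a} the averages of
   [f (x + a) - f x] telescope to O(1/n). *)
Lemma invariant_mean : exists M : (G -> R) -> R, is_mean M.
Proof.
have [U [UU UF]] := ultraFilterLemma (@refines_proper R G).
have U0 : \forall t \near U, t != [::].
  by apply: UF; exists [:: 0] => // t [].
exists (fun f => lim (avg^~ f @ U)).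
have cv (f : G -> R) : bounded f -> avg^~ f @ U --> lim (avg^~ f @ U).
  move=> [B fB]; apply: (@ultra_bounded_cvg _ _ (avg^~ f) B) => //.
  by apply: filterS U0 => t; exact: norm_avg.
split.
- move=> f g bf bg; apply/cvg_lim => //.
  by under eq_fun do rewrite avgD; apply: cvgD; exact: cv.
- move=> c f bf; apply/cvg_lim => //.
  by under eq_fun do rewrite avgZ; apply: cvgM; [exact: cvg_cst|exact: cv].
- move=> f bf f0; apply: limr_ge; first exact: cv.
  apply: filterS U0 => t t0; rewrite -(avg_cst 0 t0); exact: ler_avg.
- move=> c; apply/cvg_lim => //; apply: cvg_near_cst.
  by apply: filterS U0 => t t0; rewrite avg_cst.
- move=> f a [B fB].
  have bf : bounded f by exists B.
  have B0 : 0 <= B by rewrite (le_trans _ (fB 0)).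
  have bfa := bounded_comp (fun x => x + a) bf.
  pose d x := f (x + a) - f x.
  have cvd : avg^~ d @ U --> lim (avg^~ (fun x => f (x + a)) @ U) - lim (avg^~ f @ U).
    have -> : avg^~ d = (fun t => avg t (fun x => f (x + a)) - avg t f).
      apply/funext => t; rewrite -[X in _ = _ + X]mulN1r -avgZ -avgD.
      by congr avg; apply/funext => x; rewrite mulN1r.
    by apply: cvgB; exact: cv.
  apply/eqP; rewrite -subr_eq0 -normr_le0; apply/ler_addgt0Pl => r r0.
  rewrite addr0; pose n := (Num.bound (2 * B / r)).+1.
  have nd : (2 * B) / n%:R <= r.
    rewrite ler_pdivrMr// [r * _]mulrC -ler_pdivrMr// ltW//.
    rewrite (lt_trans (archi_boundP _))// ?ltr_nat//.
    by rewrite divr_ge0 ?mulr_ge0// ltW.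
  have dr : \forall t \near U, `|avg t d| <= r.
    have : U (@refines R G [seq a *+ k | k <- iota 0 n]).
      by apply: UF; exists [seq a *+ k | k <- iota 0 n].
    apply: filterS => t [_ [e e0 te]]; rewrite te.
    apply: le_trans nd; apply: norm_avg => // b.
    rewrite /avg big_map size_map size_iota normrM [`|_^-1|]ger0_norm//.
    rewrite ler_wpM2r//.
    rewrite (_ : \sum_(_ <- _) _ = f (a *+ n + b) - f (a *+ 0 + b)); last first.
      rewrite -(@telescope_sumr _ 0 n (fun k => f (a *+ k + b)))//.
      rewrite /index_iota subn0; apply: eq_bigr => k _.
      by rewrite /d mulrSr [_ + a]addrAC.
    by rewrite (le_trans (ler_normB _ _))// mulr_natl mulr2n lerD.
  rewrite -(cvg_lim _ cvd)// ler_norml; apply/andP; split.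
    apply: limr_ge; first exact: cvgP cvd.
    by apply: filterS dr => t; rewrite ler_norml => /andP[].
  apply: limr_le; first exact: cvgP cvd.
  by apply: filterS dr => t; rewrite ler_norml => /andP[].
Qed.

Context (M : (G -> R) -> R) (MM : is_mean M).

Lemma meanB f g : bounded f -> bounded g ->
  M (fun x => f x - g x) = M f - M g.
Proof.
move=> bf bg; rewrite -[X in _ = _ + X]mulN1r -(meanZ MM)// -(meanD MM)//.
  by congr M; apply/funext => x; rewrite mulN1r.
exact: bounded_scale.
Qed.

Lemma ler_mean f g : bounded f -> bounded g -> (forall x, f x <= g x) ->
  M f <= M g.
Proof.
move=> bf bg fg; rewrite -subr_ge0 -meanB//; apply: (mean_ge0 MM).
  exact: bounded_sub.
by move=> x; rewrite subr_ge0.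
Qed.

Lemma bounded_sum (I : Type) (r : seq I) (f : I -> G -> R) :
  (forall i, bounded (f i)) -> bounded (fun x => \sum_(i <- r) f i x).
Proof.
move=> bf; elim: r => [|i r IH].
  by under eq_fun do rewrite big_nil; exact: bounded_cst.
by under eq_fun do rewrite big_cons; exact: bounded_add.
Qed.

Lemma mean_sum (I : Type) (r : seq I) (f : I -> G -> R) :
  (forall i, bounded (f i)) ->
  M (fun x => \sum_(i <- r) f i x) = \sum_(i <- r) M (f i).
Proof.
move=> bf; elim: r => [|i r IH].
  by under eq_fun do rewrite big_nil; rewrite big_nil (mean_cst MM).
under eq_fun do rewrite big_cons.
by rewrite big_cons -IH; apply: (meanD MM) => //; exact: bounded_sum.
Qed.

Lemma norm_mean f (B : R) : (forall x, `|f x| <= B) -> `|M f| <= B.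
Proof.
move=> fB; have bf : bounded f by exists B.
have fBB x : - B <= f x <= B by rewrite -ler_norml.
rewrite ler_norml; apply/andP; split.
  rewrite -[leLHS](mean_cst MM); apply: ler_mean => // [|x].
    exact: bounded_cst.
  by have /andP[] := fBB x.
rewrite -[leRHS](mean_cst MM); apply: ler_mean => // [|x].
  exact: bounded_cst.
by have /andP[] := fBB x.
Qed.

End Mean.

(** * Continuous functions on a compact group *)

Section CompactGroup.
Context {R : realType} {G : topologicalZmodType}.
Context (cG : compact [set: G]).

Lemma continuous_bounded (f : G -> R) : continuous f -> bounded f.
Proof.
move=> cf; have : compact (f @` setT).
  by apply: continuous_compact => //; exact: continuous_subspaceT.
move=> /compact_bounded[B [_ /(_ (B + 1))]]; rewrite ltrDl ltr01 => /(_ isT) fB.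
by exists (B + 1) => x; apply: fB; exists x.
Qed.

Lemma finite_net (V : set G) : nbhs 0 V ->
  exists s : seq G, forall x, exists2 a, a \in s & V (x - a).
Proof.
move=> V0; have /compact_near_coveringP := cG.
(* Eventually along [F] means: for every sequence containing some fixed finite one. The
   near-covering form of compactness then yields a single finite net. *)
pose F := filter_from [set: seq G] (fun s => [set t : seq G | {subset s <= t}]).
have FF : ProperFilter F.
  apply: filter_from_proper; last by move=> s _; exists s => x.
  apply: filter_from_filter; first by exists [::].
  move=> s t _ _; exists (s ++ t) => // u su.
  by split=> x xs; apply: su; rewrite mem_cat xs ?orbT.
move=> /(_ _ F (fun s x => exists2 a, a \in s & V (x - a)) _)[x _|t _ Ht].
  exists ([set x' | V (x' - x)], [set t : seq G | x \in t]).
    split=> /=; last by exists [:: x] => // t; apply; rewrite mem_head.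
    have : (fun y => y - x) @ x --> x - x.
      apply: (@continuous_comp _ _ _ (fun y => (y, - x)) (fun z => z.1 + z.2)).
        by apply: cvg_pair; [exact: cvg_id|exact: cvg_cst].
      exact: add_continuous.
    by apply; rewrite subrr.
  by move=> [x' t] [/= Vx' xt]; exists x.
by exists t => x; exact: (Ht t).
Qed.

Lemma uniform_continuity (f : G -> R) : continuous f -> forall e, 0 < e ->
  exists2 V, nbhs 0 V & forall x v, V v -> `|f (x + v) - f x| < e.
Proof.
move=> cf e e0; have /compact_near_coveringP := cG.
move=> /(_ _ (nbhs (0 : G)) (fun v x => `|f (x + v) - f x| < e) _) nc.
suff /nc V0 : forall x, [set: G] x -> \forall x' \near x & v \near nbhs (0 : G),
    `|f (x' + v) - f x'| < e.
  by exists [set v | [set: G] `<=` (fun x => `|f (x + v) - f x| < e)] => // x v; apply.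
move=> x _.
have : (fun z : G * G => f (z.1 + z.2) - f z.1) @ (x, 0 : G) -->
    f (x + 0) - f x.
  apply: cvgB.
    apply: (@cvg_comp _ _ _ (fun z : G * G => z.1 + z.2) f).
      exact: (add_continuous (x, 0 : G)).
    exact: cf.
  by apply: (@cvg_comp _ _ _ fst f); [exact: cvg_fst|exact: cf].
by rewrite addr0 subrr => /cvgr0Pnorm_lt/(_ _ e0).
Qed.

(** By compactness finitely many translates of [f] add up to at least [f x0 / 2] everywhere, and all
    of them have mean [M f]. *)
Lemma mean_gt0 M (f : G -> R) (x0 : G) : is_mean M -> continuous f ->
  (forall x, 0 <= f x) -> 0 < f x0 -> 0 < M f.
Proof.
move=> MM cf f0 fx0; have bf := continuous_bounded cf.
have fx2 : 0 < f x0 / 2 by rewrite divr_gt0.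
have [V V0 fV] := uniform_continuity cf fx2.
have [s sV] := finite_net V0.
have : f x0 / 2 <= \sum_(a <- s) M (fun x => f (x + (x0 - a))).
  rewrite -(mean_sum MM) => [|a]; last exact: bounded_comp.
  rewrite -[leLHS](mean_cst MM); apply: (ler_mean MM) => [||x].
  - exact: bounded_cst.
  - by apply: bounded_sum => a; exact: bounded_comp.
  have [a /path.splitPr[s1 s2] Va] := sV x.
  have := fV x0 _ Va; rewrite addrCA ltr_norml => /andP[+ _].
  rewrite big_cat big_cons/=.
  have H t : 0 <= \sum_(i <- t) f (x + (x0 - i)) by exact: sumr_ge0.
  have := H s1; have := H s2.
  set A := \sum_(_ <- _) _; set B := \sum_(_ <- _) _; lra.
rewrite (eq_bigr (fun=> M f)) => [|a _]; last exact: (mean_shift MM).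
move=> /(lt_le_trans fx2).
rewrite big_const_seq count_predT iter_addr_0.
have := mean_ge0 MM bf f0; rewrite le_eqVlt => /predU1P[<-|//].
by rewrite mul0rn ltxx.
Qed.

Lemma invS_small (e : R) : 0 < e ->
  exists N, forall n, (N <= n)%N -> n.+1%:R^-1 < e.
Proof.
move=> e0; exists (Num.bound e^-1) => n Nn.
rewrite -[ltRHS]invrK ltf_pV2 ?posrE ?invr_gt0//.
by rewrite (lt_trans (archi_boundP _)) ?invr_ge0 ?ltW// ltr_nat ltnS.
Qed.

Definition modulus (d : G -> R) := forall e, 0 < e ->
  exists2 V, nbhs 0 V & forall v, V v -> d v < e.

(** A form of Arzela-Ascoli for functions that are equicontinuous only up to an error tending to 0.
    Tychonoff gives a pointwise cluster point [f]; the error disappears in the limit, so [d] is an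
    exact modulus for [f], and a finite net makes the approximation uniform. *)
Lemma uniform_limit_point (d : G -> R) (phi : nat -> G -> R) : modulus d ->
  (forall n x, `|phi n x| <= 1) ->
  (forall n x y, `|phi n x - phi n y| <= d (x - y) + n.+1%:R^-1) ->
  exists f : G -> R, forall e N, 0 < e ->
    exists2 n, (N <= n)%N & forall x, `|phi n x - f x| <= e.
Proof.
move=> md phi1 phid.
have cI : compact [set f : prod_topology (fun _ : G => R) |
    forall x, `[-1, 1]%classic (f x)].
  apply: (@tychonoff G (fun _ => R : topologicalType) (fun _ => `[-1, 1]%classic)).
  by move=> x; exact: segment_compact.
have [] := cI ((phi : nat -> prod_topology (fun _ : G => R)) @ \oo).
  by exists 0%N => // n _ x /=; rewrite in_itv/= -ler_norml.
move=> f [_ clf]; exists f.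
have approx (s : seq G) e N : 0 < e -> exists2 n, (N <= n)%N &
    forall a, a \in s -> `|phi n a - f a| < e.
  move=> e0.
  have [||g [[n /= Nn <-] H]] := clf (phi @` [set n | (N <= n)%N])
    [set g : prod_topology (fun _ : G => R) | forall a, a \in s -> `|g a - f a| < e].
  - by exists N => // n /= Nn; exists n.
  - elim: s => [|a s IH].
      by rewrite (_ : [set _ | _] = setT); [exact: filterT|apply/seteqP; split].
    have fa : nbhs f [set g : prod_topology (fun _ : G => R) | `|g a - f a| < e].
      apply: (@proj_continuous G (fun _ => R : topologicalType) a f [set z | `|z - f a| < e]).
      by apply/nbhs_normP; exists e => // z /=; rewrite distrC.
    apply: filterS (filterI fa IH) => g [ga gs] b; rewrite inE => /predU1P[->//|].
    exact: gs.
  - by exists n.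
have fd x y : `|f x - f y| <= d (x - y).
  apply/ler_addgt0Pr => e e0; have e3 : 0 < e / 3 by rewrite divr_gt0.
  have [N HN] := invS_small e3; have [n /HN nN na] := approx [:: x; y] _ N e3.
  have := na x (mem_head _ _); have := na y.
  rewrite !inE eqxx orbT => /(_ isT).
  have := phid n x y; rewrite !ler_norml !ltr_norml.
  move: nN; move: (_^-1) => r rn.
  move=> /andP[? ?] /andP[? ?] /andP[? ?]; apply/andP; split; lra.
move=> e N e0; have e4 : 0 < e / 4 by rewrite divr_gt0.
have [N' HN'] := invS_small e4; have [V V0 Vd] := md _ e4.
have [s sV] := finite_net V0.
have [n] := approx s _ (maxn N N') e4; rewrite geq_max => /andP[Nn /HN' nN] na.
exists n => // x; have [a /na + /Vd] := sV x.
have := phid n x a; have := fd x a.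
rewrite !ler_norml !ltr_norml; move: nN; move: (_^-1) => r rn.
move=> /andP[? ?] /andP[? ?] /andP[? ?] ?; apply/andP; split; lra.
Qed.

End CompactGroup.

(** * Existence of characters *)

Section PositiveDefinite.
Context {R : realType} {G : zmodType}.
Implicit Types (f phi psi : G -> R) (M : (G -> R) -> R).

(** The real, even version of positive definiteness: the extreme points sought are cosines, and no
    complex numbers are needed until the sine is recovered. *)
Definition posdef phi := (forall x, phi (- x) = phi x) /\
  forall s : seq (R * G),
    0 <= \sum_(p <- s) \sum_(q <- s) p.1 * q.1 * phi (p.2 - q.2).

Lemma posdef_norm phi x : posdef phi -> `|phi x| <= phi 0.
Proof.
move=> [ev pd].
have := pd [:: (1, x); (1, 0)]; have := pd [:: (1, x); (-1, 0)].
rewrite !big_cons !big_nil/= !subr0 !sub0r subrr ev ler_norml => ? ?.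
by apply/andP; split; lra.
Qed.

Lemma posdef_ge0 phi : posdef phi -> 0 <= phi 0.
Proof. by move=> /(posdef_norm 0); exact: le_trans. Qed.

Lemma posdef_scale (c : R) phi : 0 <= c -> posdef phi ->
  posdef (fun x => c * phi x).
Proof.
move=> c0 [ev pd]; split=> [x|s]; first by rewrite ev.
have := mulr_ge0 c0 (pd s); rewrite mulr_sumr.
under eq_bigr do rewrite mulr_sumr.
by under eq_bigr => p _ do under eq_bigr => q _ do rewrite mulrCA.
Qed.

(** Symmetrized in [y] so that evenness is preserved; d'Alembert's equation says that this equals
    [phi y * phi x]. *)
Definition symshift y phi x := (phi (x + y) + phi (x - y)) / 2.

(** Test [phi] on [s] together with its translate by [y] carrying the sign [(-1) ^+ e]: the
    quadratic form obtained is twice the one wanted. *)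
Lemma posdef_symshift (e : bool) y phi : posdef phi ->
  posdef (fun x => phi x + (-1) ^+ e * symshift y phi x).
Proof.
move=> [ev pd]; split=> [x|s].
  rewrite /symshift ev -(ev (- x + y)) -(ev (- x - y)) !opprD !opprK.
  by rewrite [phi (x - y) + _]addrC.
set sg : R := (-1) ^+ e; have sg2 : sg * sg = 1 by rewrite -expr2 sqrr_sign.
have := pd (s ++ [seq (sg * p.1, p.2 + y) | p <- s]).
rewrite big_cat big_map/= -big_split/=.
move=> H; rewrite -(pmulr_lge0 _ (ltr0Sn R 1)).
apply: le_trans H _; rewrite mulr_suml le_eqVlt; apply/orP; left; apply/eqP.
apply: eq_bigr => p _; rewrite !big_cat !big_map/= -!big_split/= mulr_suml.
apply: eq_bigr => q _; rewrite /symshift.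
rewrite (_ : p.2 - (q.2 + y) = p.2 - q.2 - y); last by rewrite opprD addrA.
rewrite (_ : p.2 + y - q.2 = p.2 - q.2 + y); last by rewrite addrAC.
rewrite (_ : p.2 + y - (q.2 + y) = p.2 - q.2); last by rewrite opprD addrACA subrr addr0.
rewrite (_ : sg * p.1 * (sg * q.1) = p.1 * q.1); last by rewrite mulrACA sg2 mul1r.
by field.
Qed.

Lemma posdef_limit phi :
  (forall e, 0 < e -> exists2 psi, posdef psi & forall x, `|psi x - phi x| <= e) ->
  posdef phi.
Proof.
move=> H; split=> [x|s].
  apply/eqP; rewrite -subr_eq0 -normr_le0; apply/ler_addgt0Pr => e e0.
  rewrite add0r; have e2 : 0 < e / 2 by rewrite divr_gt0.
  have [psi [ev _] pe] := H _ e2; have := pe x; have := pe (- x).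
  rewrite ev !ler_norml => /andP[? ?] /andP[? ?]; apply/andP; split; lra.
pose C : R := \sum_(p <- s) \sum_(q <- s) `|p.1 * q.1|.
have C0 : 0 <= C by apply: sumr_ge0 => p _; exact: sumr_ge0.
rewrite -oppr_le0; apply/ler_addgt0Pr => e e0; rewrite add0r.
have [psi [_ pd] pe] := H (e / (C + 1)) (divr_gt0 e0 (ltr_pwDr ltr01 C0)).
have ps := pd s.
have : \sum_(p <- s) \sum_(q <- s) p.1 * q.1 * (psi (p.2 - q.2) - phi (p.2 - q.2))
    <= C * (e / (C + 1)).
  rewrite /C mulr_suml; apply: ler_sum => p _; rewrite mulr_suml.
  apply: ler_sum => q _; rewrite (le_trans (ler_norm _))// normrM.
  by rewrite ler_wpM2l.
have -> : \sum_(p <- s) \sum_(q <- s) p.1 * q.1 * (psi (p.2 - q.2) - phi (p.2 - q.2)) =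
  \sum_(p <- s) \sum_(q <- s) p.1 * q.1 * psi (p.2 - q.2) -
  \sum_(p <- s) \sum_(q <- s) p.1 * q.1 * phi (p.2 - q.2).
  rewrite -sumrB; apply: eq_bigr => p _; rewrite -sumrB; apply: eq_bigr => q _.
  by rewrite mulrBr.
have : C * (e / (C + 1)) <= e.
  rewrite mulrCA ger_pMr// ler_pdivrMr ?mul1r ?lerDl// ltr_wpDl//.
move: ps; set A := \sum_(_ <- _) _; set B := \sum_(_ <- _) _; lra.
Qed.

(** By invariance the quadratic form is the mean of the square of a combination of translates of
    [v]. *)
Lemma posdef_autocorrelation M v : is_mean M -> bounded v ->
  posdef (fun x => M (fun y => v (x + y) * v y)).
Proof.
move=> MM bv.
have bvv (a b : G) : bounded (fun y => v (a + y) * v (b + y)).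
  by apply: bounded_mul; exact: bounded_comp.
have bv0 (a : G) : bounded (fun y => v (a + y) * v y).
  by apply: bounded_mul => //; exact: bounded_comp.
have sh (a b : G) : M (fun y => v (a - b + y) * v y) =
    M (fun y => v (a + y) * v (b + y)).
  rewrite -(mean_shift MM b)//; congr M; apply/funext => y.
  by rewrite [y + b]addrC addrA subrK.
split=> [x|s].
  rewrite -[- x]add0r sh; congr M; apply/funext => y.
  by rewrite add0r mulrC.
rewrite (_ : \sum_(p <- s) _ = M (fun y => (\sum_(p <- s) p.1 * v (p.2 + y)) ^+ 2)).
  apply: (mean_ge0 MM) => [|y]; last exact: sqr_ge0.
  apply: bounded_mul; apply: bounded_sum => p; apply: bounded_scale;
    exact: bounded_comp.
under [X in M X]eq_fun do rewrite expr2 mulr_suml.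
rewrite (mean_sum MM) => [|p]; last first.
  apply: bounded_mul; first by apply: bounded_scale; exact: bounded_comp.
  by apply: bounded_sum => q; apply: bounded_scale; exact: bounded_comp.
apply: eq_bigr => p _.
under [X in M X]eq_fun do rewrite mulr_sumr.
rewrite (mean_sum MM) => [|q]; last first.
  by apply: bounded_mul; apply: bounded_scale; exact: bounded_comp.
apply: eq_bigr => q _; rewrite sh -(meanZ MM)//.
by congr M; apply/funext => y; rewrite mulrACA.
Qed.

End PositiveDefinite.

(** * Compactness and the existence of maximizers *)

Section Maximizer.
Context {R : realType} {G : topologicalZmodType} (cG : compact [set: G]).

(** Used twice: for the linear functional, and for [M (phi ^+ 2)] on the face where the linear one
    is maximal. The term [K * (m - L phi)] admits functions whose equicontinuity fails by an amount
    controlled by their distance from the maximum, which vanishes along a maximizing sequence. *)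
Lemma maximizer (Q : set (G -> R)) (L : (G -> R) -> R) (d : G -> R) (K C m : R) :
  modulus d -> 0 <= K -> 0 <= C ->
  (forall phi, Q phi -> forall x, `|phi x| <= 1) ->
  (forall phi, Q phi ->
     forall x y, `|phi x - phi y| <= d (x - y) + K * (m - L phi)) ->
  (forall f, (forall e, 0 < e -> exists2 phi, Q phi & forall x, `|phi x - f x| <= e) ->
     Q f) ->
  (forall phi psi e, Q phi -> Q psi -> (forall x, `|phi x - psi x| <= e) ->
     `|L phi - L psi| <= C * e) ->
  (forall phi, Q phi -> L phi <= m) ->
  (forall e, 0 < e -> exists2 phi, Q phi & m - e < L phi) ->
  exists2 phi, Q phi & L phi = m.
Proof.
move=> md K0 C0 Q1 Qd Qcl LC Lm Lsup.
(* Dividing by [K + 1] makes the error [K * (m - L (phi n))] at most [n.+1%:R^-1], as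
   [uniform_limit_point] requires, also when [K = 0]. *)
have e0 n : 0 < n.+1%:R^-1 / (K + 1) by rewrite divr_gt0 ?invr_gt0 ?ltr_wpDl.
have /choice[phi Hphi] : forall n : nat, exists phi,
    Q phi /\ m - n.+1%:R^-1 / (K + 1) < L phi.
  by move=> n; have [phi ? ?] := Lsup _ (e0 n); exists phi.
have phiK n : K * (m - L (phi n)) <= n.+1%:R^-1.
  have [Qn Ln] := Hphi n.
  have Ln' : m - L (phi n) <= n.+1%:R^-1 / (K + 1).
    by rewrite lerBlDl -lerBlDr ltW.
  rewrite (le_trans (ler_wpM2l K0 Ln'))// mulrCA ger_pMr ?invr_gt0//.
  by rewrite ler_pdivrMr ?ltr_wpDl// mul1r lerDl.
have [|n x y|f Hf] := uniform_limit_point cG md (phi := phi).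
- by move=> n x; apply: Q1; case: (Hphi n).
- by rewrite (le_trans (Qd _ (Hphi n).1 x y))// lerD2l.
have Qf : Q f.
  apply: Qcl => e /(Hf e 0%N)[n _ fn]; exists (phi n) => //.
  by case: (Hphi n).
exists f => //; apply/eqP; rewrite eq_le Lm//=.
apply/ler_addgt0Pr => e epos.
have e2 : 0 < e / 2 by rewrite divr_gt0.
have [N HN] := invS_small e2.
have eC : 0 < e / 2 / (C + 1) by rewrite divr_gt0// ltr_wpDl.
have [n /HN nN fn] := Hf _ N eC; have [Qn Ln] := Hphi n.
have := LC _ _ _ Qn Qf fn.
have CC : C * (e / 2 / (C + 1)) <= e / 2.
  by rewrite mulrCA ger_pMr// ler_pdivrMr ?ltr_wpDl// mul1r lerDl.
have nK : n.+1%:R^-1 / (K + 1) <= n.+1%:R^-1.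
  by rewrite ger_pMr ?invr_gt0// invf_le1 ?ltr_wpDl// lerDr.
move: nN Ln nK; move: (_%:R^-1) => r; move: (r / _) => r'.
rewrite ler_norml => ? ? ? /andP[? ?]; lra.
Qed.

Lemma uniform_limit_continuous (f : G -> R) :
  (forall e, 0 < e -> exists2 phi : G -> R, continuous phi &
     forall x, `|phi x - f x| <= e) -> continuous f.
Proof.
move=> H x; apply/cvgrPdist_le => e e0.
have e3 : 0 < e / 3 by rewrite divr_gt0.
have [phi cphi pf] := H _ e3.
have /cvgrPdist_le/(_ _ e3) := cphi x; apply: filterS => y.
have := pf x; have := pf y; rewrite !ler_norml.
by move=> /andP[? ?] /andP[? ?] /andP[? ?]; apply/andP; split; lra.
Qed.

(** The modulus is the supremum of the oscillation over all base points, which makes it even;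
    [symshift] shifts by both [y] and [- y]. *)
Lemma modulus_shift (f : G -> R) : continuous f ->
  exists2 d : G -> R, modulus d & (forall v, d (- v) = d v) /\
    forall x v, `|f (x + v) - f x| <= d v.
Proof.
move=> cf; have [B fB] := continuous_bounded cG cf.
pose A v := [set r | exists x, r = `|f (x + v) - f x|].
have AB v : has_sup (A v).
  split; first by exists (`|f (0 + v) - f 0|); exists 0.
  exists (B + B) => _ [x ->].
  by rewrite (le_trans (ler_normB _ _))// lerD.
exists (fun v => sup (A v)).
  move=> e e0; have e2 : 0 < e / 2 by rewrite divr_gt0.
  have [V V0 Vf] := uniform_continuity cG cf e2.
  exists V => // v Vv; apply: (@le_lt_trans _ _ (e / 2)); last by lra.
  apply: ge_sup; first by case: (AB v).
  by move=> _ [x ->]; rewrite ltW// Vf.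
split=> [v|x v].
  congr sup; apply/seteqP; split=> r [x ->].
    by exists (x - v); rewrite subrK distrC.
  by exists (x + v); rewrite addrK distrC.
by apply: ub_le_sup; [case: (AB v)|exists x].
Qed.

End Maximizer.

(** * Extreme positive definite functions and d'Alembert's equation *)

Section Extremal.
Context {R : realType} {G : topologicalZmodType} (cG : compact [set: G]).
Context (M : (G -> R) -> R) (MM : is_mean M).
Implicit Types (phi psi : G -> R).

Definition normalized_posdef phi :=
  [/\ posdef phi, phi 0 = 1 & continuous phi].

Let npd_norm phi : normalized_posdef phi -> forall x, `|phi x| <= 1.
Proof. by move=> [pd p0 _] x; rewrite -p0; exact: posdef_norm. Qed.

Let npd_limit f :
  (forall e, 0 < e -> exists2 phi, normalized_posdef phi &
     forall x, `|phi x - f x| <= e) -> normalized_posdef f.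
Proof.
move=> H; split.
- by apply: posdef_limit => e /H[psi [? _ _] ?]; exists psi.
- apply/eqP; rewrite -subr_eq0 -normr_le0; apply/ler_addgt0Pr => e e0.
  by have [psi [_ <- _] pf] := H _ e0; rewrite add0r distrC.
- by apply: uniform_limit_continuous => e /H[psi [_ _ ?] ?]; exists psi.
Qed.

Let cbd (f : G -> R) : continuous f -> bounded f.
Proof. exact: continuous_bounded. Qed.

Lemma continuous_shift (f : G -> R) a : continuous f ->
  continuous (fun x => f (x + a)).
Proof.
move=> cf x; apply: (@continuous_comp _ _ _ (fun x => x + a) f); last exact: cf.
apply: (@cvg_comp _ _ _ (fun y => (y, a)) (fun z => z.1 + z.2)).
  by apply: (@cvg_pair _ _ _ _ (nbhs x) (nbhs a)); [exact: cvg_id|exact: cvg_cst].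
exact: (add_continuous (x, a)).
Qed.

Lemma continuous_symshift y (f : G -> R) : continuous f ->
  continuous (symshift y f).
Proof.
move=> cf x; apply: cvgM; last exact: cvg_cst.
by apply: cvgD; exact: continuous_shift.
Qed.

Section DAlembert.
Context (f0 : G -> R) (cf0 : continuous f0).
Context (phi0 : G -> R) (nphi0 : normalized_posdef phi0).
Context (phi0_gt0 : 0 < M (fun x => f0 x * phi0 x)).

Let ell phi := M (fun x => f0 x * phi x).

Let bf0 phi : continuous phi -> bounded (fun x => f0 x * phi x).
Proof. by move=> cp; apply: bounded_mul; exact: cbd. Qed.

Let ellZ c phi : continuous phi -> ell (fun x => c * phi x) = c * ell phi.
Proof.
move=> cp; rewrite /ell -(meanZ MM)//; last exact: bf0.
by congr M; apply/funext => x; rewrite mulrCA.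
Qed.

Let ellD phi psi : continuous phi -> continuous psi ->
  ell (fun x => phi x + psi x) = ell phi + ell psi.
Proof.
move=> cp cs; rewrite /ell -(meanD MM); [|exact: bf0|exact: bf0].
by congr M; apply/funext => x; rewrite mulrDr.
Qed.

Let ellB phi psi : continuous phi -> continuous psi ->
  ell (fun x => phi x - psi x) = ell phi - ell psi.
Proof.
move=> cp cs; rewrite /ell -(meanB MM); [|exact: bf0|exact: bf0].
by congr M; apply/funext => x; rewrite mulrBr.
Qed.

Let ell_lip : exists2 C, 0 <= C & forall phi psi e, continuous phi ->
  continuous psi -> (forall x, `|phi x - psi x| <= e) ->
  `|ell phi - ell psi| <= C * e.
Proof.
have [B fB] := cbd cf0; exists B; first exact: le_trans (fB 0).
move=> phi psi e cp cs pe; rewrite -ellB//.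
by apply: (norm_mean MM) => x; rewrite normrM ler_pM.
Qed.

Let lam := sup [set ell phi | phi in normalized_posdef].

Let has_lam : has_sup [set ell phi | phi in normalized_posdef].
Proof.
split; first by exists (ell phi0); exists phi0.
have [B fB] := cbd cf0; exists B => _ [phi np <-].
rewrite (le_trans (ler_norm _))//; apply: (norm_mean MM) => x.
rewrite normrM -[leRHS]mulr1 ler_pM//; exact: npd_norm.
Qed.

Let ell_lam phi : normalized_posdef phi -> ell phi <= lam.
Proof. by move=> np; apply: ub_le_sup; [case: has_lam|exists phi]. Qed.

Let lam_gt0 : 0 < lam.
Proof. exact: lt_le_trans phi0_gt0 (ell_lam nphi0). Qed.

Let posdef_eq0 psi : posdef psi -> psi 0 = 0 -> psi = fun=> 0.
Proof.
move=> pd p0; apply/funext => x; apply/eqP.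
by rewrite -normr_le0 -p0 posdef_norm.
Qed.

Let npd_scale psi : posdef psi -> continuous psi -> psi 0 != 0 ->
  normalized_posdef (fun x => (psi 0)^-1 * psi x).
Proof.
move=> pd cp p0; split.
- by apply: posdef_scale => //; rewrite invr_ge0 posdef_ge0.
- by rewrite mulVf.
- by move=> x; apply: cvgM; [exact: cvg_cst|exact: cp].
Qed.

Let ell_le psi : posdef psi -> continuous psi -> ell psi <= lam * psi 0.
Proof.
move=> pd cp; have [p0|p0] := eqVneq (psi 0) 0.
  rewrite p0 mulr0 /ell (posdef_eq0 pd p0).
  by under eq_fun do rewrite mulr0; rewrite (mean_cst MM).
have := ell_lam (npd_scale pd cp p0); rewrite ellZ// ler_pdivrMl ?lt_def ?p0//.
  by rewrite mulrC.
exact: posdef_ge0.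
Qed.

(* [ell psi <= lam * psi 0] holds for [psi = phi + symshift y phi] and for
   [psi = phi - symshift y phi]; hence near-maximizers of [ell] are approximate
   eigenfunctions, and therefore almost equicontinuous. *)
Let ell_symshift phi y : normalized_posdef phi ->
  `|lam * phi y - ell (symshift y phi)| <= lam - ell phi.
Proof.
move=> [pd p0 cp].
have cs := continuous_symshift (y := y) cp.
have H (e : bool) : ell phi + (-1) ^+ e * ell (symshift y phi) <=
    lam * (1 + (-1) ^+ e * phi y).
  have := ell_le (posdef_symshift e y pd).
  rewrite ellD//; last by move=> x; apply: cvgM; [exact: cvg_cst|exact: cs].
  rewrite ellZ// {3}/symshift add0r sub0r pd.1 -[phi y + phi y]mulr2n p0.
  rewrite -[phi y *+ 2]mulr_natr mulfK//; apply.
  move=> x; apply: cvgD; first exact: cp.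
  by apply: cvgM; [exact: cvg_cst|exact: cs].
have := H true; have := H false; rewrite expr0 expr1 !mul1r !mulN1r.
rewrite ler_norml => ? ?; apply/andP; split; lra.
Qed.

(** Invariance of the mean moves the shift from [phi] to [f0], so the modulus depends on [f0] alone
    and is common to all [phi]. *)
Let ell_modulus : exists2 d : G -> R, modulus d & forall phi,
  normalized_posdef phi -> forall x y,
  `|ell (symshift x phi) - ell (symshift y phi)| <= d (x - y).
Proof.
have [d md [dN df]] := modulus_shift cG cf0; exists d => // phi np x y.
have [_ _ cp] := np.
have sh a : M (fun z => f0 z * phi (z + a)) = M (fun z => f0 (z - a) * phi z).
  rewrite -[RHS](mean_shift MM a).
    by congr M; apply/funext => z; rewrite addrK.
  by apply: bounded_mul; [apply: cbd; exact: continuous_shift|exact: cbd].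
have bsh a : bounded (fun z => f0 (z - a) * phi z).
  by apply: bounded_mul; [apply: cbd; exact: continuous_shift|exact: cbd].
have bsh' a : bounded (fun z => f0 z * phi (z + a)).
  by apply: bounded_mul; [exact: cbd|apply: cbd; exact: continuous_shift].
pose P a := M (fun z => f0 (z - a) * phi z).
have E a : ell (symshift a phi) = 2^-1 * (P a + P (- a)).
  rewrite /P -!sh -(meanD MM)// -(meanZ MM); last exact: bounded_add.
  by congr M; apply/funext => z; rewrite /symshift; field.
have D a b : `|P a - P b| <= d (a - b).
  rewrite /P -(meanB MM)//; apply: (norm_mean MM) => z.
  rewrite -mulrBl normrM -[leRHS]mulr1 ler_pM ?npd_norm//.
  by have := df (z - a) (a - b); rewrite addrA subrK distrC.
have D1 := D x y; have := D (- x) (- y).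
rewrite -opprD dN => D2.
rewrite !E; move: D1 D2; rewrite !ler_norml.
by move=> /andP[? ?] /andP[? ?]; apply/andP; split; lra.
Qed.

Let attained : exists2 phi, normalized_posdef phi & ell phi = lam.
Proof.
have [d md dell] := ell_modulus; have [C C0 lip] := ell_lip.
(* The eigenfunction defect [lam - ell phi] is incurred at [x] and at [y], whence the 2; dividing by
   [lam] turns a bound on [lam * (phi x - phi y)] into one on [phi]. *)
apply: (@maximizer _ _ cG _ _ (fun v => lam^-1 * d v) (2 / lam) C).
- move=> e e0; have [V V0 Vd] := md (e * lam) (mulr_gt0 e0 lam_gt0).
  by exists V => // v /Vd; rewrite -ltr_pdivrMr// mulrC.
- by rewrite divr_ge0// ltW.
- exact: C0.
- exact: npd_norm.
- move=> phi np x y.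
  rewrite -(ler_pM2l lam_gt0) mulrDr mulrA divff ?gt_eqF// mul1r.
  rewrite -{1}[lam]gtr0_norm// -normrM mulrA [lam * (_ / _)]mulrC divfK ?gt_eqF//.
  have := dell _ np x y; have := ell_symshift x np; have := ell_symshift y np.
  rewrite mulrBr !ler_norml.
  by move=> /andP[? ?] /andP[? ?] /andP[? ?]; apply/andP; split; lra.
- exact: npd_limit.
- by move=> phi psi e [_ _ cp] [_ _ cs]; exact: lip.
- exact: ell_lam.
- move=> e e0; have [_ [phi np <-] H] := sup_adherent e0 has_lam.
  by exists phi.
Qed.

Let top := [set phi | normalized_posdef phi /\ ell phi = lam].

Let top_eigen phi y : top phi -> ell (symshift y phi) = lam * phi y.
Proof.
move=> [np el]; have := ell_symshift y np.
by rewrite el subrr normr_le0 subr_eq0 => /eqP.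
Qed.

Let top_sq : exists2 phi, top phi & forall psi, top psi ->
  M (fun x => psi x ^+ 2) <= M (fun x => phi x ^+ 2).
Proof.
have [d md dell] := ell_modulus; have [C C0 lip] := ell_lip.
have [phi1 np1 l1] := attained.
have bsq psi : top psi -> bounded (fun x => psi x ^+ 2).
  by move=> [[_ _ cp] _]; apply: bounded_mul; exact: cbd.
pose S := [set M (fun x => phi x ^+ 2) | phi in top].
have hS : has_sup S.
  split; first by exists (M (fun x => phi1 x ^+ 2)); exists phi1.
  exists 1 => _ [phi tp <-]; rewrite -[leRHS](mean_cst MM).
  apply: (ler_mean MM) => [||x]; [exact: bsq|exact: bounded_cst|].
  rewrite -[leRHS](expr1n _ 2) -real_normK ?num_real// lerXn2r ?nnegrE ?npd_norm//.
  by case: tp.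
suff [phi tp Sp] : exists2 phi, top phi & M (fun x => phi x ^+ 2) = sup S.
  exists phi => // psi ts; rewrite Sp; apply: ub_le_sup; first by case: hS.
  by exists psi.
(* On the face the eigenfunction equation is exact, so the error constant is 0. The 2 bounds
   [psi + phi] in the factorization of the difference of squares. *)
apply: (@maximizer _ _ cG _ _ (fun v => lam^-1 * d v) 0 2).
- move=> e e0; have [V V0 Vd] := md (e * lam) (mulr_gt0 e0 lam_gt0).
  by exists V => // v /Vd; rewrite -ltr_pdivrMr// mulrC.
- by [].
- by [].
- by move=> phi [np _]; exact: npd_norm.
- move=> phi tp x y; rewrite mul0r addr0.
  rewrite -(ler_pM2l lam_gt0) mulrA divff ?gt_eqF// mul1r.
  rewrite -{1}[lam]gtr0_norm// -normrM mulrBr -!top_eigen//.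
  by apply: dell; case: tp.
- move=> f H; have nf : normalized_posdef f.
    by apply: npd_limit => e /H[psi [? _] ?]; exists psi.
  split=> //; apply/eqP; rewrite -subr_eq0 -normr_le0.
  apply/ler_addgt0Pr => e e0; rewrite add0r.
  have eC : 0 < e / (C + 1) by rewrite divr_gt0// ltr_wpDl.
  have [psi [np <-] pf] := H _ eC; rewrite distrC.
  have [_ _ cp] := np; have [_ _ cf] := nf.
  rewrite (le_trans (lip _ _ _ cp cf pf))//.
  by rewrite mulrCA ger_pMr// ler_pdivrMr ?ltr_wpDl// mul1r lerDl.
- move=> phi psi e tp ts pe; rewrite -(meanB MM); [|exact: bsq|exact: bsq].
  apply: (norm_mean MM) => x; rewrite subr_sqr normrM mulrC ler_pM//.
  have [np _] := tp; have [ns _] := ts.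
  by rewrite (le_trans (ler_normD _ _))// -[leRHS](_ : 1 + 1 = 2)// lerD ?npd_norm.
- by move=> phi tp; apply: ub_le_sup; [case: hS|exists phi].
- move=> e e0; have [_ [phi tp <-] H] := sup_adherent e0 hS.
  by exists phi.
Qed.

(* A maximizer of the strictly convex functional [M (phi ^+ 2)] on the face
   [top] is an extreme point, so the splitting
   [2 phi = (phi + symshift y phi) + (phi - symshift y phi)] is trivial. *)
Lemma dalembert_exists : exists2 phi, normalized_posdef phi &
  (forall x y, phi (x + y) + phi (x - y) = 2 * phi x * phi y) /\
  0 < M (fun x => f0 x * phi x).
Proof.
have [phi tp Mphi] := top_sq; have [np el] := tp; have [pd p0 cp] := np.
exists phi => //; split; last by rewrite -/(ell phi) el.
suff H y : symshift y phi = (fun x => phi y * phi x).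
  move=> x y; have /(congr1 (fun h => h x)) := H y.
  by rewrite -mulrA [phi x * _]mulrC => <-; rewrite /symshift; field.
have cs := continuous_symshift (y := y) cp.
pose psi (e : bool) x := phi x + (-1) ^+ e * symshift y phi x.
have pdp e : posdef (psi e) by exact: posdef_symshift.
have cpp e : continuous (psi e).
  move=> x; apply: cvgD; first exact: cp.
  by apply: cvgM; [exact: cvg_cst|exact: cs].
have psi0 e : psi e 0 = 1 + (-1) ^+ e * phi y.
  rewrite /psi p0 /symshift add0r sub0r pd.1; congr (_ + _ * _).
  by field.
(* A positive definite function vanishing at 0 is zero, so in the two degenerate cases
   [symshift y phi] is [- phi] or [phi], with [phi y] equal to -1 or 1; otherwise both summands can
   be normalized. *)
have [yp|yp] := eqVneq (psi false 0) 0.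
  have := posdef_eq0 (pdp _) yp; rewrite psi0 expr0 mul1r in yp.
  move=> /(congr1 (fun h => h _)) E; apply/funext => x; have := E x.
  rewrite /psi expr0 mul1r.
  by have -> : phi y = -1 by [lra]; lra.
have [ym|ym] := eqVneq (psi true 0) 0.
  have := posdef_eq0 (pdp _) ym; rewrite psi0 expr1 mulN1r in ym.
  move=> /(congr1 (fun h => h _)) E; apply/funext => x; have := E x.
  rewrite /psi expr1 mulN1r.
  by have -> : phi y = 1 by [lra]; lra.
have nz e : psi e 0 != 0 by case: e.
have gz e : 0 < psi e 0 by rewrite lt_def nz posdef_ge0.
pose chi e x := (psi e 0)^-1 * psi e x.
have tc e : top (chi e).
  split; first exact: npd_scale.
  rewrite ellZ// ellD//; last by move=> x; apply: cvgM; [exact: cvg_cst|exact: cs].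
  rewrite ellZ// el top_eigen// psi0.
  have -> : lam + (-1) ^+ e * (lam * phi y) = lam * (1 + (-1) ^+ e * phi y) by ring.
  by rewrite mulrCA -psi0 mulVf// mulr1.
have cc e : continuous (chi e) by case: (tc e) => -[].
pose al := psi false 0 / 2; pose be := psi true 0 / 2.
have albe : al + be = 1 by rewrite /al /be !psi0 expr0 expr1; field.
have al0 : 0 < al by rewrite divr_gt0.
have be0 : 0 < be by rewrite divr_gt0.
have phiE x : phi x = al * chi false x + be * chi true x.
  have c e : psi e 0 / 2 * ((psi e 0)^-1 * psi e x) = psi e x / 2.
    by rewrite mulrAC mulVKf.
  by rewrite /al /be /chi !c /psi expr0 expr1; field.
(* Strict convexity of the square made explicit: the last term is the loss, and by maximality of
   [phi] its mean must vanish. *)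
have sqE x : phi x ^+ 2 = al * chi false x ^+ 2 + be * chi true x ^+ 2 -
    al * be * (chi false x - chi true x) ^+ 2.
  by rewrite phiE; have -> : be = 1 - al by [lra]; ring.
have bc (u v : G -> R) : continuous u -> continuous v -> bounded (fun x => u x * v x).
  by move=> cu cv; apply: bounded_mul; exact: cbd.
have cdiff : continuous (fun x => chi false x - chi true x).
  by move=> x; apply: cvgB; exact: cc.
have ME : M (fun x => phi x ^+ 2) = al * M (fun x => chi false x ^+ 2) +
    be * M (fun x => chi true x ^+ 2) -
    al * be * M (fun x => (chi false x - chi true x) ^+ 2).
  under eq_fun do rewrite sqE.
  rewrite (meanB MM) ?(meanD MM) ?(meanZ MM)//;
    do ?[exact: bc|apply: bounded_add|apply: bounded_scale].
have eqc : chi false = chi true.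
  apply/funext => x; apply/eqP; rewrite -subr_eq0; apply: contrapT => /negP nx.
  have : 0 < M (fun x => (chi false x - chi true x) ^+ 2).
    apply: (mean_gt0 cG (x0 := x)) => // [z|z|]; [|exact: sqr_ge0|].
      by apply: cvgM; exact: cdiff.
    by rewrite lt_def sqrf_eq0 nx sqr_ge0.
  have := Mphi _ (tc false); have := Mphi _ (tc true); rewrite ME.
  set A := M _; set B := M _; set D := M _ => hB hA D0.
  have := mulr_gt0 (mulr_gt0 al0 be0) D0.
  have := ler_wpM2l (ltW al0) hA; have := ler_wpM2l (ltW be0) hB.
  rewrite -/A -/B; nra.
apply/funext => x.
have : chi false x = phi x by rewrite phiE eqc -mulrDl albe mul1r.
rewrite /chi => /(congr1 (fun r => psi false 0 * r)); rewrite mulVKf//.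
by rewrite psi0 /psi expr0 !mul1r; lra.
Qed.

End DAlembert.
End Extremal.

(** * From d'Alembert's equation to characters *)

Section Characters.
Context {R : realType} {G : topologicalZmodType}.

Definition is_character (chi : G -> R[i]) :=
  [/\ forall x y, chi (x + y) = chi x * chi y,
      forall x, chi x * conjc (chi x) = 1,
      continuous (fun x => complex.Re (chi x)) &
      continuous (fun x => complex.Im (chi x))].

(* If [phi = cos theta], the sine comes from
   [cos (theta x - theta b) - cos (theta x + theta b) = 2 sin (theta x) sin (theta b)]. *)
Lemma dalembert_character (phi : G -> R) : continuous phi -> phi 0 = 1 ->
  (forall x, `|phi x| <= 1) ->
  (forall x y, phi (x + y) + phi (x - y) = 2 * phi x * phi y) ->
  exists2 chi : G -> R[i], is_character chi &
    forall a, chi a = 1 -> forall x, phi (x + a) = phi x.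
Proof.
move=> cp p0 p1 dal.
(* If every value of [phi] is 1 or -1, no sine can be read off, but [phi] is then itself a
   character. *)
have [[b pb]|/forallNP H] := pselect (exists b, phi b ^+ 2 != 1); last first.
  have sq x : phi x ^+ 2 = 1.
    by apply/eqP; apply: contrapT => /negP; exact: H.
  have phiM x y : phi (x + y) = phi x * phi y.
    have pm z : phi z = 1 \/ phi z = -1.
      by have /eqP := sq z; rewrite sqrf_eq1 => /orP[] /eqP; tauto.
    have := dal x y.
    by have [->|->] := pm x; have [->|->] := pm y; have [->|->] := pm (x + y);
      have [->|->] := pm (x - y); lra.
  exists (fun x => Complex (phi x) 0).
    split=> //=.
    - move=> x y; rewrite phiM; apply/eqP.
      by rewrite eq_complex/= !mulr0 !mul0r subr0 addr0 !eqxx.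
    - move=> x; apply/eqP.
      by rewrite eq_complex/= oppr0 !mulr0 mul0r subr0 addr0 -expr2 sq !eqxx.
    - by move=> x; exact: cvg_cst.
  by move=> a [pa] x; rewrite phiM pa mulr1.
have pb1 : 0 < 1 - phi b ^+ 2.
  rewrite subr_gt0 lt_def eq_sym pb/=.
  by rewrite -[leRHS](expr1n _ 2) -real_normK ?num_real// lerXn2r ?nnegrE.
pose s := Num.sqrt (1 - phi b ^+ 2).
have s0 : 0 < s by rewrite sqrtr_gt0.
have s2 : s ^+ 2 = 1 - phi b ^+ 2 by rewrite sqr_sqrtr// ltW.
pose S x := (phi (x - b) - phi (x + b)) / (2 * s).
have prod x y : phi x * phi y = (phi (x + y) + phi (x - y)) / 2.
  by rewrite dal; field.
have ev x : phi (- x) = phi x.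
  by have := dal 0 x; rewrite add0r sub0r p0; lra.
have C2 x y : phi (x + y) = phi x * phi y - S x * S y.
  have -> : S x * S y =
      (phi (x - b) - phi (x + b)) * (phi (y - b) - phi (y + b)) / (4 * s ^+ 2).
    by rewrite /S; field; rewrite gt_eqF.
  apply: (@mulIf _ (4 * s ^+ 2)); first by rewrite mulf_neq0 ?sqrf_eq0 ?gt_eqF.
  rewrite mulrBl divfK; last by rewrite mulf_neq0 ?sqrf_eq0 ?gt_eqF.
  rewrite s2.
  have mm : phi (x - b) * phi (y - b) = (phi (x + y - (b + b)) + phi (x - y)) / 2.
    by rewrite prod; congr ((phi _ + phi _) / _);
      [rewrite opprD addrACA|rewrite opprB addrA subrK].
  have mp : phi (x - b) * phi (y + b) = (phi (x + y) + phi (x - y - (b + b))) / 2.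
    by rewrite prod; congr ((phi _ + phi _) / _);
      [rewrite addrACA addNr addr0|rewrite !opprD addrACA].
  have pm : phi (x + b) * phi (y - b) = (phi (x + y) + phi (x - y + (b + b))) / 2.
    by rewrite prod; congr ((phi _ + phi _) / _);
      [rewrite addrACA subrr addr0|rewrite opprB [b - y]addrC addrACA].
  have pp : phi (x + b) * phi (y + b) = (phi (x + y + (b + b)) + phi (x - y)) / 2.
    by rewrite prod; congr ((phi _ + phi _) / _);
      [rewrite addrACA|rewrite opprD addrACA subrr addr0].
  have b2 := dal b b; rewrite subrr p0 in b2.
  have P2 := dal (x + y) (b + b); have Q2 := dal (x - y) (b + b).
  have xy := dal x y.
  have -> : phi b ^+ 2 = (phi (b + b) + 1) / 2 by rewrite b2; field.
  have -> : phi x * phi y = (phi (x + y) + phi (x - y)) / 2 by rewrite xy; field.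
  lra.
have S2 x y : S (x + y) = S x * phi y + phi x * S y.
  have e1 : phi (x - b) * phi y = (phi (x + y - b) + phi (x - y - b)) / 2.
    by rewrite prod; congr ((phi _ + phi _) / _);
      [rewrite addrAC|rewrite addrAC].
  have e2 : phi (x + b) * phi y = (phi (x + y + b) + phi (x - y + b)) / 2.
    by rewrite prod; congr ((phi _ + phi _) / _);
      [rewrite addrAC|rewrite addrAC].
  have e3 : phi x * phi (y - b) = (phi (x + y - b) + phi (x - y + b)) / 2.
    by rewrite prod; congr ((phi _ + phi _) / _);
      [rewrite addrA|rewrite opprB [b - y]addrC addrA].
  have e4 : phi x * phi (y + b) = (phi (x + y + b) + phi (x - y - b)) / 2.
    by rewrite prod; congr ((phi _ + phi _) / _);
      [rewrite addrA|rewrite opprD addrA].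
  rewrite /S mulrAC [phi x * _]mulrA -mulrDl; congr (_ / _).
  by rewrite mulrBl mulrBr e1 e2 e3 e4; field.
have CS x : phi x ^+ 2 + S x ^+ 2 = 1.
  have SN : S (- x) = - S x.
    rewrite /S -opprD ev -(ev (- x + b)) opprD opprK; field.
    by rewrite gt_eqF.
  have := C2 x (- x); rewrite subrr p0 ev SN.
  by rewrite mulrN opprK -!expr2 => <-.
exists (fun x => Complex (phi x) (S x)).
  split=> //=.
  - by move=> x y; apply/eqP; rewrite eq_complex/= C2 S2 eqxx/= addrC [S x * _]mulrC eqxx.
  - move=> x; apply/eqP; rewrite eq_complex/= mulrN opprK -!expr2 CS eqxx/=.
    by rewrite mulrN addrC mulrC subrr.
  - move=> x; apply: cvgM; last exact: cvg_cst.
    by apply: cvgB; exact: continuous_shift.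
by move=> a [pa Sa] x; rewrite C2 pa Sa mulr1 mulr0 subr0.
Qed.

Lemma autocorrelation_continuous M (v : G -> R) : compact [set: G] ->
  is_mean M -> continuous v -> continuous (fun x => M (fun y => v (x + y) * v y)).
Proof.
move=> cG MM cv; have [B vB] := continuous_bounded cG cv.
have bv := continuous_bounded cG cv.
have B0 : 0 <= B := le_trans (normr_ge0 _) (vB 0).
have [d md [dN df]] := modulus_shift cG cv.
move=> x; apply/cvgrPdist_le => e e0.
have eB : 0 < e / (B + 1) by rewrite divr_gt0// ltr_wpDl.
have [V V0 Vd] := md _ eB.
have : nbhs x [set y | V (y - x)].
  have : (fun y => y - x) @ x --> x - x.
    apply: (@cvg_comp _ _ _ (fun y => (y, - x)) (fun z => z.1 + z.2)).
      by apply: (@cvg_pair _ _ _ _ (nbhs x) (nbhs (- x))); [exact: cvg_id|exact: cvg_cst].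
    exact: (add_continuous (x, - x)).
  by rewrite subrr; apply.
apply: filterS => z /= /Vd dz.
have bvv a : bounded (fun y => v (a + y) * v y).
  by apply: bounded_mul => //; exact: bounded_comp.
rewrite -(meanB MM)//; apply: (@le_trans _ _ (d (z - x) * B)).
  apply: (norm_mean MM) => y; rewrite -mulrBl normrM ler_pM//.
  by rewrite distrC; have := df (x + y) (z - x); rewrite [x + y + _]addrC addrA subrK.
apply: (@le_trans _ _ (e / (B + 1) * B)); first by rewrite ler_wpM2r// ltW.
by rewrite mulrAC -mulrA ger_pMr// ler_pdivrMr ?ltr_wpDl// mul1r lerDl.
Qed.

(* The autocorrelation of [u - u (. + x0)] has mean zero against every function
   of period [x0], so the character found is not trivial at [x0]. *)
Theorem characters_separate (x0 : G) : compact [set: G] -> hausdorff_space G ->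
  x0 != 0 -> exists2 chi : G -> R[i], is_character chi & chi x0 != 1.
Proof.
move=> cG hG x00.
have [M MM] := @invariant_mean R G.
have nG := compact_normal hG cG.
have cl1 (a : G) : closed [set a].
  by apply: compact_closed => //; exact: compact_set1.
have [u [cu u0 u1 _]] : exists u : G -> R, [/\ continuous u,
    [set u x | x in [set 0]] `<=` [set 0], [set u x | x in [set x0]] `<=` [set 1] &
    range u `<=` `[0, 1]].
  apply: urysohn_ext_itv => //.
  by apply/seteqP; split=> // x [/= -> /esym/eqP]; rewrite (negPf x00).
have {}u0 : u 0 = 0 by apply: u0; exists 0.
have {}u1 : u x0 = 1 by apply: u1; exists x0.
pose v x := u x - u (x + x0).
have cv : continuous v by move=> x; apply: cvgB; [exact: cu|exact: continuous_shift].
have bv := continuous_bounded cG cv.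
have bu := continuous_bounded cG cu.
pose f0 x := M (fun y => v (x + y) * v y).
have cf0 : continuous f0 by exact: autocorrelation_continuous.
have pf0 : posdef f0 by exact: posdef_autocorrelation.
have f00 : 0 < f0 0.
  apply: (mean_gt0 cG (x0 := 0)) => //.
  - by move=> x; under eq_fun do rewrite add0r; apply: cvgM; exact: cv.
  - by move=> x; rewrite add0r -expr2 sqr_ge0.
  - by rewrite add0r /v add0r u0 u1 sub0r mulrN1 opprK.
pose phi0 x := (f0 0)^-1 * f0 x.
have nphi0 : normalized_posdef phi0.
  split; first by apply: posdef_scale => //; rewrite invr_ge0 ltW.
    by rewrite /phi0 mulVf// gt_eqF.
  by move=> x; apply: cvgM; [exact: cvg_cst|exact: cf0].
have phi0_gt0 : 0 < M (fun x => f0 x * phi0 x).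
  apply: (mean_gt0 cG (x0 := 0)) => //.
  - by move=> x; apply: cvgM; [exact: cf0|apply: cvgM; [exact: cvg_cst|exact: cf0]].
  - by move=> x; rewrite mulrCA -expr2 mulr_ge0 ?sqr_ge0// invr_ge0 ltW.
  - by rewrite /phi0 mulVf ?gt_eqF// mulr1.
have [phi [pd p0 cp] [dal Mphi]] := dalembert_exists cG MM cf0 nphi0 phi0_gt0.
have phi1 x : `|phi x| <= 1 by rewrite -p0 posdef_norm.
have [chi cchi chiP] := dalembert_character cp p0 phi1 dal.
exists chi => //; apply/eqP => /chiP per.
move: Mphi; pose F x := M (fun y => u (x + y) * v y).
have bF : bounded F.
  have [B uB] := bu; have [C vC] := bv; exists (B * C) => x.
  by apply: (norm_mean MM) => y; rewrite normrM ler_pM.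
have bp := continuous_bounded cG cp.
have f0E x : f0 x = F x - F (x + x0).
  rewrite /f0 /F -(meanB MM); [|by apply: bounded_mul => //; exact: bounded_comp..].
  by congr M; apply/funext => y; rewrite /v -mulrBl [x + x0 + y]addrAC.
rewrite (_ : (fun x => _) = (fun x => F x * phi x - F (x + x0) * phi (x + x0))).
  rewrite (meanB MM); [|exact: bounded_mul|].
    rewrite (mean_shift MM (f := fun x => F x * phi x)) ?subrr ?ltxx//.
    exact: bounded_mul.
  by apply: bounded_mul; exact: (bounded_comp (fun x => x + x0)).
by apply/funext => x; rewrite f0E per mulrBl.
Qed.

End Characters.

(** * Duality for compact groups *)

Section Dual.
Context {R : realType} {G : topologicalZmodType}.
Implicit Types chi eta : G -> R[i].

(** The Pontryagin dual, given an additive group law below so that integer multiples and rank can be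
    discussed as for any abelian group. *)
Definition dual := {chi : G -> R[i] | is_character chi}.

HB.instance Definition _ := gen_eqMixin dual.
HB.instance Definition _ := gen_choiceMixin dual.

Definition ev (chi : dual) : G -> R[i] := sval chi.

Lemma dual_ext (chi eta : dual) : (forall x, ev chi x = ev eta x) -> chi = eta.
Proof.
case: chi eta => [f fP] [g gP] /= fg; apply: eq_exist.
by apply/funext => x; exact: fg.
Qed.

Lemma character0 : is_character (fun _ : G => 1 : R[i]).
Proof.
split=> [x y|x|x|x]; [by rewrite mulr1|by rewrite conjc1 mulr1|exact: cvg_cst..].
Qed.

Lemma characterN chi : is_character chi -> is_character (fun x => conjc (chi x)).
Proof.
move=> [cD c1 cR cI]; split=> [x y|x||].
- by rewrite cD rmorphM.
- by rewrite conjcK mulrC c1.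
- have -> : (fun x => complex.Re (conjc (chi x))) = (fun x => complex.Re (chi x)).
    by apply/funext => x; case: (chi x).
  exact: cR.
- have -> : (fun x => complex.Im (conjc (chi x))) = (fun x => - complex.Im (chi x)).
    by apply/funext => x; case: (chi x).
  by move=> x; apply: cvgN; exact: cI.
Qed.

Lemma characterD chi eta : is_character chi -> is_character eta ->
  is_character (fun x => chi x * eta x).
Proof.
move=> [cD c1 cR cI] [eD e1 eR eI]; split=> [x y|x||].
- by rewrite cD eD mulrACA.
- by rewrite rmorphM mulrACA c1 e1 mulr1.
- have -> : (fun x => complex.Re (chi x * eta x)) = (fun x =>
      complex.Re (chi x) * complex.Re (eta x) - complex.Im (chi x) * complex.Im (eta x)).
    by apply/funext => x; case: (chi x) (eta x) => ? ? [].
  by move=> x; apply: cvgB; apply: cvgM; by [exact: cR|exact: cI|exact: eR|exact: eI].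
- have -> : (fun x => complex.Im (chi x * eta x)) = (fun x =>
      complex.Re (chi x) * complex.Im (eta x) + complex.Im (chi x) * complex.Re (eta x)).
    by apply/funext => x; case: (chi x) (eta x) => ? ? [].
  by move=> x; apply: cvgD; apply: cvgM; by [exact: cR|exact: cI|exact: eR|exact: eI].
Qed.

Definition dual_zero : dual := exist _ _ character0.
Definition dual_opp (chi : dual) : dual := exist _ _ (characterN (svalP chi)).
Definition dual_add (chi eta : dual) : dual :=
  exist _ _ (characterD (svalP chi) (svalP eta)).

Lemma ev_norm (chi : dual) x : ev chi x * conjc (ev chi x) = 1.
Proof. by case: chi => f []. Qed.

Lemma dual_addA : associative dual_add.
Proof. by move=> a b c; apply: dual_ext => x; exact: mulrA. Qed.
Lemma dual_addC : commutative dual_add.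
Proof. by move=> a b; apply: dual_ext => x; exact: mulrC. Qed.
Lemma dual_add0 : left_id dual_zero dual_add.
Proof. by move=> a; apply: dual_ext => x; exact: mul1r. Qed.
Lemma dual_addN : left_inverse dual_zero dual_opp dual_add.
Proof. by move=> a; apply: dual_ext => x; rewrite /ev/= mulrC; exact: ev_norm. Qed.

HB.instance Definition _ :=
  GRing.isZmodule.Build dual dual_addA dual_addC dual_add0 dual_addN.

Implicit Types kappa : dual.

Lemma ev_addl kappa kappa' x : ev (kappa + kappa') x = ev kappa x * ev kappa' x.
Proof. by []. Qed.

Lemma ev_0l x : ev 0 x = 1.
Proof. by []. Qed.

Lemma ev_oppl kappa x : ev (- kappa) x = conjc (ev kappa x).
Proof. by []. Qed.

Lemma ev_addr kappa x y : ev kappa (x + y) = ev kappa x * ev kappa y.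
Proof. by case: kappa => f []. Qed.

Lemma ev_neq0 kappa x : ev kappa x != 0.
Proof.
by apply/eqP => k0; have := ev_norm kappa x; rewrite k0 mul0r => /esym/eqP; rewrite oner_eq0.
Qed.

Lemma ev_0r kappa : ev kappa 0 = 1.
Proof.
apply: (mulfI (ev_neq0 kappa 0)); by rewrite -ev_addr addr0 mulr1.
Qed.

Lemma ev_oppr kappa x : ev kappa (- x) = conjc (ev kappa x).
Proof.
apply: (mulfI (ev_neq0 kappa x)); by rewrite -ev_addr subrr ev_0r ev_norm.
Qed.

Lemma ev_mulrn_l kappa x n : ev (kappa *+ n) x = ev kappa x ^+ n.
Proof. by elim: n => [|n IH]; rewrite ?mulr0n// mulrS exprS ev_addl IH. Qed.

Lemma ev_mulrn_r kappa x n : ev kappa (x *+ n) = ev kappa x ^+ n.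
Proof. by elim: n => [|n IH]; rewrite ?mulr0n ?ev_0r// mulrS exprS ev_addr IH. Qed.

Lemma ev_mulrz kappa x (n : int) : ev (kappa *~ n) x = ev kappa (x *~ n).
Proof.
case: n => n; first by rewrite -!pmulrn ev_mulrn_l ev_mulrn_r.
by rewrite !NegzE !mulrNz -!pmulrn ev_oppl ev_oppr ev_mulrn_l ev_mulrn_r.
Qed.

Lemma ev_continuous kappa : continuous (fun x => complex.Re (ev kappa x)) /\
  continuous (fun x => complex.Im (ev kappa x)).
Proof. by case: kappa => f []. Qed.

(* Near a zero of [kappa] all the powers [kappa x ^+ k] with [k < n] have
   positive real part, so their sum does not vanish; hence the kernel of a
   torsion character is open. *)
Lemma dual_torsion_free kappa n : connected [set: G] -> (0 < n)%N ->
  kappa *+ n = 0 -> kappa = 0.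
Proof.
move=> coG n0 kn; apply: dual_ext => x; rewrite ev_0l.
pose K := [set x | ev kappa x = 1].
have KE : K = K `&` setT by rewrite setIT.
have Kclosed : closed K.
  have -> : K = [set x | complex.Re (ev kappa x) = 1] `&`
      [set x | complex.Im (ev kappa x) = 0].
    apply/seteqP; split=> y; rewrite /K/=; first by move=> ->.
    by case: (ev kappa y) => a b /= [-> ->].
  have [cR cI] := ev_continuous kappa.
  apply: closedI.
    exact: (closed_comp (fun z _ => cR z) (@closed_eq _ 1)).
  exact: (closed_comp (fun z _ => cI z) (@closed_eq _ 0)).
have Kopen : open K.
  rewrite openE => y Ky.
  have : \forall z \near y, forall k : 'I_n, 0 < complex.Re (ev (kappa *+ k) z).
    apply: filter_forall => k.
    have [cR _] := ev_continuous (kappa *+ k).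
    have : (fun z => complex.Re (ev (kappa *+ k) z)) @ y -->
        complex.Re (ev (kappa *+ k) y) := cR y.
    rewrite ev_mulrn_l [ev _ _]Ky expr1n/=.
    by move=> /cvgr_gt/(_ 0); rewrite ltr01 => /(_ isT).
  apply: filterS => z zk; rewrite /K/=; apply/eqP; rewrite -subr_eq0.
  have := subrX1 (ev kappa z) n; rewrite -ev_mulrn_l kn ev_0l subrr.
  move=> /esym/eqP; rewrite mulf_eq0 => /orP[//|/eqP S0].
  have : 0 < \sum_(i < n) complex.Re (ev (kappa *+ i) z).
    case: n n0 zk {kn S0} => // n _ zk; rewrite big_ord_recl ltr_pwDl//.
    by apply: sumr_ge0 => i _; rewrite ltW.
  suff -> : \sum_(i < n) complex.Re (ev (kappa *+ i) z) =
      complex.Re (\sum_(i < n) ev kappa z ^+ i) by rewrite S0/= ltxx.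
  by rewrite raddf_sum; apply: eq_bigr => i _; rewrite ev_mulrn_l.
have := coG K _ _ _; rewrite -[ev kappa x = 1]/(K x) => ->//.
- by exists 0; rewrite /K/= ev_0r.
- by exists K; rewrite ?setTI.
- by exists K; rewrite ?setTI.
Qed.

Lemma dual_torsion_free_int kappa (n : int) : connected [set: G] -> n != 0 ->
  kappa *~ n = 0 -> kappa = 0.
Proof.
move=> coG; case: n => [[//|n]|n] _; rewrite ?NegzE ?mulrNz -?pmulrn.
  exact: dual_torsion_free.
by move=> /eqP; rewrite oppr_eq0 => /eqP; exact: dual_torsion_free.
Qed.

End Dual.
Arguments dual : clear implicits.
Arguments ev : simpl never.

(** * Geometric decay beats polynomial growth *)

Section PolynomialGeometric.
Context {R : realType}.

Lemma bernoulli (h : R) n : 0 <= h -> 1 + n%:R * h <= (1 + h) ^+ n.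
Proof.
move=> h0; elim: n => [|n IH]; first by rewrite mul0r addr0 expr0.
rewrite exprS; apply: le_trans (ler_wpM2l _ IH); last by rewrite addr_ge0.
have : 0 <= n%:R * h * h by rewrite !mulr_ge0.
by rewrite -natr1; nra.
Qed.

Lemma linear_geometric (r : R) : 0 <= r -> r < 1 ->
  exists2 N, (0 < N)%N & N.+1%:R * r ^+ N < 1.
Proof.
rewrite le_eqVlt => /predU1P[<-|r0] r1.
  by exists 1%N => //; rewrite expr1 mulr0.
pose h := r^-1 - 1; have h0 : 0 < h by rewrite subr_gt0 invf_gt1.
have rE : r = (1 + h)^-1 by rewrite /h addrC subrK invrK.
(* Chosen so that [n * h ^+ 2] is at least 2; then [(1 + n * h) ^+ 2], a lower bound for
   [(1 + h) ^+ (n * 2)], exceeds [2 * n + 1]. *)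
pose n := (Num.bound (2 / h ^+ 2)).+1.
have nh : 2 <= n%:R * h ^+ 2.
  rewrite -ler_pdivrMr ?exprn_gt0// ltW// (lt_trans (archi_boundP _))//.
    by rewrite divr_ge0// sqr_ge0.
  by rewrite ltr_nat.
exists (n * 2)%N; first by rewrite muln_gt0.
have hn : 0 < (1 + h) ^+ (n * 2) by rewrite exprn_gt0// addr_gt0.
rewrite rE exprVn ltr_pdivrMr// mul1r exprM.
apply: (@lt_le_trans _ _ ((1 + n%:R * h) ^+ 2)); last first.
  have b := @bernoulli h n (ltW h0).
  have b0 : 0 <= 1 + n%:R * h by rewrite addr_ge0// mulr_ge0// ltW.
  by rewrite lerXn2r ?nnegrE// (le_trans b0).
rewrite -natr1 natrM; have nn : 1 <= n%:R :> R by rewrite ler1n.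
have : 0 < n%:R * h by rewrite mulr_gt0// ltr0n.
have : 2 * n%:R <= n%:R * h ^+ 2 * n%:R by rewrite ler_wpM2r.
by nra.
Qed.

(** Bernoulli's inequality bounds [rho] by a power [(1 - t) ^+ k] with the exponent of the
    polynomial factor, which reduces the claim to a power of the linear case. *)
Lemma polynomial_geometric (rho : R) k : 0 <= rho -> rho < 1 ->
  exists N, N.+1%:R ^+ k * rho ^+ N < 1.
Proof.
move=> rho0 rho1; case: k => [|k].
  by exists 1%N; rewrite mul1r expr1.
pose t := (1 - rho) / k.+1%:R; have t0 : 0 < t by rewrite divr_gt0// subr_gt0.
have tk : k.+1%:R * t = 1 - rho by rewrite /t mulrCA divff ?mulr1// pnatr_eq0.
have t1 : t <= 1.
  rewrite /t ler_pdivrMr// mul1r (@le_trans _ _ 1)//; first by lra.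
  by rewrite ler1n.
have bern n : 1 - n%:R * t <= (1 - t) ^+ n.
  elim: n => [|n IH]; first by rewrite mul0r subr0 expr0.
  rewrite exprS; apply: le_trans (ler_wpM2l _ IH); last by lra.
  have := mulr_ge0 (mulr_ge0 (ler0n R n) (ltW t0)) (ltW t0).
  by rewrite -natr1; nra.
have rt : rho <= (1 - t) ^+ k.+1 by apply: le_trans (bern _); lra.
have [||N N0 HN] := @linear_geometric (1 - t); [lra|lra|].
exists N; apply: (@le_lt_trans _ _ ((N.+1%:R * (1 - t) ^+ N) ^+ k.+1)).
  rewrite exprMn exprAC ler_wpM2l ?exprn_ge0// lerXn2r// nnegrE exprn_ge0//; lra.
rewrite exprn_ilt1// mulr_ge0// exprn_ge0//; lra.
Qed.

End PolynomialGeometric.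

(** * Kronecker's theorem *)

Section Kronecker.
Context {R : realType} {G : topologicalZmodType} (cG : compact [set: G]).
Context (A : zmodType) (rho : {additive A -> dual R G}) (z : A -> R[i]).
Context (zD : forall a b, z (a + b) = z a * z b).
Context (z1 : forall a, z a * conjc (z a) = 1).
Context (ker : forall a, rho a = 0 -> z a = 1).

(** The point [x] solves the problem exactly when every [w a x] is 1. Leaving [rho] general covers
    two uses: multiplication by an integer gives divisibility of [G], the identity gives
    one-parameter subgroups. *)
Let w a x := ev (rho a) x * conjc (z a).

Let wD a b x : w (a + b) x = w a x * w b x.
Proof. by rewrite /w raddfD ev_addl zD rmorphM mulrACA. Qed.

Let w_norm a x : w a x * conjc (w a x) = 1.
Proof. by rewrite /w rmorphM/= conjcK mulrACA ev_norm [_ * z a]mulrC z1 mulr1. Qed.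

Let z0 : z 0 = 1. Proof. by rewrite ker// raddf0. Qed.

Let w0 x : w 0 x = 1.
Proof. by rewrite /w z0 conjc1 mulr1 raddf0. Qed.

Let wN a x : w (- a) x = conjc (w a x).
Proof.
have w_neq0 : w a x != 0.
  by apply/eqP => k0; have := w_norm a x; rewrite k0 mul0r => /esym/eqP; rewrite oner_eq0.
by apply: (mulfI w_neq0); rewrite w_norm -wD subrr w0.
Qed.

Let wMn a n x : w (a *+ n) x = w a x ^+ n.
Proof. by elim: n => [|n IH]; rewrite ?mulr0n ?w0// mulrS exprS wD IH. Qed.

Let wcts a : continuous (fun x => complex.Re (w a x)) /\
  continuous (fun x => complex.Im (w a x)).
Proof.
have [cR cI] := ev_continuous (rho a); rewrite /w; case: (z a) => p q; split=> x.
  have -> : (fun x => complex.Re (ev (rho a) x * conjc (Complex p q))) =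
    (fun x => complex.Re (ev (rho a) x) * p - complex.Im (ev (rho a) x) * (- q)).
    by apply/funext => y; case: (ev _ _).
  by apply: cvgB; apply: cvgM; by [exact: cvg_cst|exact: cR|exact: cI].
have -> : (fun x => complex.Im (ev (rho a) x * conjc (Complex p q))) =
    (fun x => complex.Re (ev (rho a) x) * (- q) + complex.Im (ev (rho a) x) * p).
  by apply/funext => y; case: (ev _ _).
by apply: cvgD; apply: cvgM; by [exact: cvg_cst|exact: cR|exact: cI].
Qed.

Context (M : (G -> R) -> R) (MM : is_mean M).

Let bRe a : bounded (fun x => complex.Re (w a x)).
Proof. by apply: (continuous_bounded cG); case: (wcts a). Qed.

Let bIm a : bounded (fun x => complex.Im (w a x)).
Proof. by apply: (continuous_bounded cG); case: (wcts a). Qed.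

(** Shifting by [y] multiplies the complex mean of [w a] by [ev (rho a) y]; so the mean is 0 unless
    [rho a] is trivial, and then [w a] is constantly 1 by [ker]. *)
Let mean_w_ge0 a : 0 <= M (fun x => complex.Re (w a x)).
Proof.
have [ra|ra] := eqVneq (rho a) 0.
  rewrite /w ra ker// (_ : (fun=> _) = (fun=> 1)) ?(mean_cst MM)//.
  by apply/funext => x; rewrite ev_0l conjc1 mulr1.
have [y chiy] : exists y, ev (rho a) y != 1.
  apply: contrapT => /forallNP H; move/eqP: ra; apply; apply: dual_ext => y.
  by rewrite ev_0l; apply/eqP; apply: contrapT => /negP; exact: H.
set p := M _; pose q := M (fun x => complex.Im (w a x)).
have wy x : w a (x + y) = w a x * ev (rho a) y by rewrite /w ev_addr mulrAC.
have [c [s' cs]] : exists c s, ev (rho a) y = Complex c s.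
  by case: (ev _ y) => c s; exists c, s.
have pE : p = p * c - q * s'.
  rewrite {1}/p -(mean_shift MM y)// [p * c]mulrC [q * _]mulrC /p /q.
  rewrite -(meanZ MM)// -(meanZ MM)// -(meanB MM); [|exact: bounded_scale..].
  congr M; apply/funext => x; rewrite wy cs; case: (w a x) => u v/=; ring.
have qE : q = p * s' + q * c.
  rewrite {1}/q -(mean_shift MM y)// [p * _]mulrC [q * _]mulrC /p /q.
  rewrite -(meanZ MM)// -(meanZ MM)// -(meanD MM); [|exact: bounded_scale..].
  congr M; apply/funext => x; rewrite wy cs; case: (w a x) => u v/=; ring.
have : Complex p q * (ev (rho a) y - 1) = 0.
  rewrite cs mulrBr mulr1; apply/eqP; rewrite eq_complex/=.
  by rewrite -pE -qE !subrr eqxx.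
move=> /eqP; rewrite mulf_eq0 subr_eq0 (negPf chiy) orbF eq_complex/=.
by move=> /andP[/eqP -> _].
Qed.

(** A convex combination with [L] terms. The count is the point: since powers of [w a] are again of
    the form [w (a *+ k)], an [N]-th power of [(1 + w a) / 2] needs only [N.+1] terms. *)
Definition w_combination (L : nat) (Q : G -> R[i]) := exists (T : finType)
  (c : T -> R) (k : T -> A),
  [/\ #|T| = L, forall t, 0 <= c t, \sum_t c t = 1 &
      forall x, Q x = \sum_t (c t)%:C%C * w (k t) x].

Let combM L L' Q Q' : w_combination L Q -> w_combination L' Q' ->
  w_combination (L * L') (fun x => Q x * Q' x).
Proof.
move=> [T [c [k [TL c0 c1 QE]]]] [T' [c' [k' [TL' c0' c1' QE']]]].
exists (T * T')%type, (fun t => c t.1 * c' t.2), (fun t => k t.1 + k' t.2); split.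
- by rewrite card_prod TL TL'.
- by move=> t; rewrite mulr_ge0.
- rewrite -(pair_bigA _ (fun i j => c i * c' j))/= -[RHS]c1; apply: eq_bigr => t _.
  by rewrite -mulr_sumr c1' mulr1.
- move=> x; rewrite QE QE' mulr_suml.
  rewrite -(pair_bigA _ (fun i j => (c i * c' j)%:C%C * w (k i + k' j) x))/=.
  apply: eq_bigr => t _; rewrite mulr_sumr; apply: eq_bigr => t' _.
  by rewrite wD rmorphM/= mulrACA.
Qed.

Let comb1 : w_combination 1 (fun=> 1).
Proof.
exists 'I_1, (fun=> 1), (fun=> 0); split; rewrite ?card_ord ?big_ord1//.
by move=> x; rewrite big_ord1 w0 mulr1.
Qed.

Let comb_binomial a N : w_combination N.+1 (fun x => ((1 + w a x) / 2) ^+ N).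
Proof.
exists 'I_N.+1, (fun k : 'I_N.+1 => 'C(N, k)%:R / 2 ^+ N), (fun k : 'I_N.+1 => a *+ k); split.
- exact: card_ord.
- by move=> k; rewrite divr_ge0.
- rewrite -mulr_suml -natr_sum -[X in X%:R / _](_ : 2 ^ N = _)%N.
    by rewrite natrX divff// expf_neq0.
  rewrite -[2%N]/(1 + 1)%N expnDn; apply: eq_bigr => i _.
  by rewrite !exp1n !muln1.
- move=> x; rewrite exprMn exprDn mulr_suml; apply: eq_bigr => k _.
  rewrite expr1n mul1r wMn -[_ *+ 'C(_, _)]mulr_natr rmorphM/= rmorph_nat.
  rewrite fmorphV rmorphXn rmorph_nat exprVn [RHS]mulrC -!mulrA; congr (_ * _).
Qed.

(** The cross terms have nonnegative mean, so the mean square is at least the sum of the squared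
    coefficients, which is at least [L%:R^-1] by Cauchy-Schwarz. *)
Let comb_mean L Q : w_combination L Q ->
  L%:R^-1 <= M (fun x => complex.Re (Q x * conjc (Q x))).
Proof.
move=> [T [c [k [TL c0 c1 QE]]]].
have -> : (fun x => complex.Re (Q x * conjc (Q x))) =
    (fun x => \sum_t \sum_t' (c t * c t') * complex.Re (w (k t - k t') x)).
  apply/funext => x; rewrite QE rmorph_sum/= mulr_suml raddf_sum/=.
  apply: eq_bigr => t _; rewrite mulr_sumr raddf_sum; apply: eq_bigr => t' _.
  have -> : conjc ((c t')%:C%C * w (k t') x) = (c t')%:C%C * conjc (w (k t') x).
    by case: (w _ x) => u v; apply/eqP; rewrite eq_complex/= !mul0r !subr0 !addr0 mulrN !eqxx.
  rewrite wD wN mulrACA -rmorphM/=.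
  by case: (w (k t) x * _) => u v/=; rewrite mul0r subr0.
rewrite (mean_sum MM) => [|t]; last by apply: bounded_sum => t'; exact: bounded_scale.
apply: (@le_trans _ _ (\sum_t c t ^+ 2)); last first.
  apply: ler_sum => t _; rewrite (mean_sum MM) => [|t']; last exact: bounded_scale.
  rewrite (bigD1 t)//= (meanZ MM)// subrr.
  have -> : (fun x => complex.Re (w 0 x)) = (fun=> 1) by apply/funext => x; rewrite w0.
  rewrite (mean_cst MM) mulr1 -expr2 lerDl; apply: sumr_ge0 => t' _.
  by rewrite (meanZ MM)// mulr_ge0// mulr_ge0.
have L0 : (0 < L)%N.
  rewrite -TL; case: (posnP #|T|) => // T0; move: c1.
  by rewrite big1 => [/esym/eqP|t]; [rewrite oner_eq0|have := fintype0 t T0].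
have : 0 <= \sum_t (c t - L%:R^-1) ^+ 2 by apply: sumr_ge0 => t _; exact: sqr_ge0.
under eq_bigr do rewrite sqrrB.
rewrite big_split sumrB/= sumrMnl -mulr_suml c1 mul1r sumr_const TL.
rewrite -[_ ^+ 2 *+ L]mulr_natr expr2 -mulrA mulVf ?pnatr_eq0 -?lt0n// mulr1.
by rewrite mulr2n; lra.
Qed.

Let w_circle a x : complex.Re (w a x) ^+ 2 + complex.Im (w a x) ^+ 2 = 1.
Proof.
have := w_norm a x; case: (w a x) => u v /(congr1 (@complex.Re R))/= <-.
by ring.
Qed.

Let w_Re_le1 a x : -1 <= complex.Re (w a x) <= 1.
Proof.
have := w_circle a x; have := sqr_ge0 (complex.Im (w a x)).
by rewrite -ler_norml => ? ?; rewrite -[leRHS]sqrtr1 -sqrtr_sqr ler_wsqrtr//; lra.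
Qed.

(** Each factor is the squared modulus of [(1 + w a x) / 2], since [w a x] lies on the unit
    circle. *)
Let P (s : seq A) x : R := \prod_(a <- s) ((1 + complex.Re (w a x)) / 2).

Let factor_itv a x : 0 <= (1 + complex.Re (w a x)) / 2 <= 1.
Proof. by have /andP[? ?] := w_Re_le1 a x; apply/andP; split; lra. Qed.

Let P_itv s x : 0 <= P s x <= 1.
Proof.
elim: s => [|a s /andP[P0 P1]]; first by rewrite /P big_nil ler01 lexx.
have /andP[f0 f1] := factor_itv a x.
by rewrite /P big_cons -/(P s x) mulr_ge0//= mulr_ile1.
Qed.

Let P_comb s N : exists2 Q, w_combination (N.+1 ^ size s) Q &
  forall x, complex.Re (Q x * conjc (Q x)) = P s x ^+ N /\ complex.Im (Q x * conjc (Q x)) = 0.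
Proof.
elim: s => [|a s [Q cQ QE]].
  exists (fun=> 1); first exact: comb1.
  by move=> x; rewrite conjc1 mulr1 /P big_nil expr1n.
exists (fun x => ((1 + w a x) / 2) ^+ N * Q x).
  by rewrite /= expnS; exact: combM (comb_binomial a N) cQ.
move=> x; have [QR QI] := QE x; rewrite rmorphM mulrACA rmorphXn/= -exprMn.
have -> : (1 + w a x) / 2 * conjc ((1 + w a x) / 2) =
    ((1 + complex.Re (w a x)) / 2)%:C%C.
  have := w_circle a x; case: (w a x) => u v /= uv.
  have -> : (1 + Complex u v) / 2 = Complex ((1 + u) / 2) (v / 2).
    have t2 : (2 : R[i]) = Complex 2 0 by rewrite -(rmorph_nat (real_complex R)).
    apply: (@mulIf _ 2); rewrite ?divfK ?pnatr_eq0// t2.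
    by apply/eqP; rewrite eq_complex/= !mulr0 subr0 add0r add0r !divfK ?pnatr_eq0// !eqxx.
  apply/eqP; rewrite eq_complex/=; apply/andP; split; apply/eqP; last by ring.
  transitivity ((1 + 2 * u + (u ^+ 2 + v ^+ 2)) / 4); first by field.
  by rewrite uv; field.
rewrite -rmorphXn /P big_cons -/(P s x) [X in _ = X /\ _]exprMn -QR /=.
move: QI; case: (Q x * _) => u v/= ->.
by rewrite !mul0r !mulr0 subr0 addr0.
Qed.

(* If no approximate solution existed, [P s <= r < 1] would give
   [M (P s ^+ N) <= r ^ N], but this mean is at least [1 / (N + 1) ^ size s]. *)
Let approximate_solution (s : seq A) (e : R) : 0 < e ->
  exists x, forall a, a \in s -> 1 - e < complex.Re (w a x).
Proof.
move=> e0; apply: contrapT => /forallNP H.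
have H' x : exists2 a, a \in s & complex.Re (w a x) <= 1 - e.
  have /existsNP[a /not_implyP[sa /negP]] := H x.
  by rewrite -leNgt; exists a.
pose r := 1 - e / 2.
have Pr x : P s x <= r.
  have [a /path.splitPr[s1 s2] wa] := H' x.
  rewrite /P big_cat big_cons/= -/(P s1 x) -/(P s2 x).
  have /andP[? ?] := P_itv s1 x; have /andP[? ?] := P_itv s2 x.
  have /andP[f0 f1] := factor_itv a x.
  apply: (@le_trans _ _ ((1 + complex.Re (w a x)) / 2)); last by rewrite /r; lra.
  by rewrite mulrCA ler_piMr// mulr_ile1.
have r0 : 0 <= r by have /andP[P0 _] := P_itv s 0; exact: le_trans (Pr 0).
have [|N HN] := @polynomial_geometric R r (size s) r0; first by rewrite /r; lra.
have [Q /comb_mean + QE] := P_comb s N.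
have -> : (fun x => complex.Re (Q x * conjc (Q x))) = (fun x => P s x ^+ N).
  by apply/funext => x; case: (QE x).
move=> ML; have MU : `|M (fun x => P s x ^+ N)| <= r ^+ N.
  apply: (norm_mean MM) => x; have /andP[P0 P1] := P_itv s x.
  by rewrite ger0_norm ?exprn_ge0// lerXn2r.
have := le_trans ML (le_trans (ler_norm _) MU).
rewrite natrX -[X in X <= _]mulr1 ler_pdivrMl ?exprn_gt0// => /le_lt_trans/(_ HN).
by rewrite ltxx.
Qed.

(* A cluster point of approximate solutions is a solution. *)
Theorem kronecker : exists x, forall a, ev (rho a) x = z a.
Proof.
pose B (p : seq A * R) := [set x | forall a, a \in p.1 -> 1 - p.2 < complex.Re (w a x)].
pose F := filter_from [set p : seq A * R | 0 < p.2] B.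
have FF : ProperFilter F.
  apply: filter_from_proper; last first.
    by move=> [s e] /= e0; have [x ?] := approximate_solution s e0; exists x.
  apply: filter_from_filter; first by exists ([::], 1) => /=.
  move=> [s e] [t d] /= e0 d0; exists (s ++ t, Num.min e d) => /=.
    by rewrite lt_min e0 d0.
  move=> x /= H; split=> a /= sa; have := H a; rewrite mem_cat sa ?orbT => /(_ isT).
    by apply: le_lt_trans; rewrite lerD2l lerN2 ge_min lexx.
  by apply: le_lt_trans; rewrite lerD2l lerN2 ge_min lexx orbT.
have [|x [_ clx]] := cG FF; first exact: filterT.
exists x => a.
have Re1 : complex.Re (w a x) = 1.
  apply/eqP; rewrite eq_le; have /andP[_ ->] := w_Re_le1 a x.
  apply/ler_addgt0Pr => e e0; have e2 : 0 < e / 2 by rewrite divr_gt0.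
  have [cR _] := wcts a.
  have /cvgrPdist_lt/(_ _ e2) := cR x => nx.
  have [y [/= By yx]] := clx (B ([:: a], e / 2)) _
    (ex_intro2 _ _ ([:: a], e / 2) e2 (fun _ => id)) nx.
  have := By a (mem_head _ _); move: yx; rewrite ltr_norml /= => /andP[? ?] ?; lra.
have Im0 : complex.Im (w a x) = 0.
  apply/eqP; rewrite -sqrf_eq0; have := w_circle a x.
  by rewrite Re1 expr1n => /eqP; rewrite -subr_eq0 addrAC subrr add0r.
have w1 : w a x = 1.
  by move: Re1 Im0; case: (w a x) => u v /= -> ->.
have /(congr1 (fun c => c * z a)) := w1.
by rewrite /w mul1r -mulrA [_ * z a]mulrC z1 mulr1.
Qed.

End Kronecker.

(** * Extending homomorphisms with values in the reals *)

Section AdditiveExtension.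
Context {R : realType} {A : zmodType}.

(** The graph of a homomorphism from a subgroup of [A] to the reals: being a subgroup, it is single
    valued as soon as its fibre over 0 is trivial. *)
Definition additive_graph (E : set (A * R)) := [/\ E 0,
  forall x y, E x -> E y -> E (x - y) & forall r, E (0, r) -> r = 0].

Lemma additive_graph_mulz E x (n : int) : additive_graph E -> E x -> E (x *~ n).
Proof.
move=> [E0 EB _] Ex; have EN y : E y -> E (- y) by move=> ?; rewrite -sub0r; exact: EB.
have En m : E (x *+ m).
  elim: m => [|m IH]; first by rewrite mulr0n.
  by rewrite mulrSr -[x in _ + x]opprK; apply: (EB) => //; exact: (EN).
by case: n => n; rewrite -?pmulrn// NegzE mulrNz; apply: EN; exact: En.
Qed.

Lemma pair_mulrz (a : A) (r : R) (n : int) : (a, r) *~ n = (a *~ n, r *~ n).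
Proof.
have H m : (a, r) *+ m = (a *+ m, r *+ m).
  by elim: m => [|m IH]; rewrite ?mulr0n// !mulrS IH.
by case: n => n; rewrite ?NegzE ?mulrNz -?pmulrn H.
Qed.

Lemma pair_sub (a b : A) (r s : R) : (a, r) - (b, s) = (a - b, r - s).
Proof. by []. Qed.

(** If a nonzero multiple of [a] is already in the domain, the value at [a] is forced and obtained
    by division in the reals; otherwise it is free and 0 is chosen. *)
Lemma additive_graph_extend E a : additive_graph E ->
  exists E', [/\ additive_graph E', E `<=` E' & exists r, E' (a, r)].
Proof.
move=> gE; have [E0 EB Ef] := gE.
have ED x y : E x -> E y -> E (x + y).
  by move=> Ex Ey; rewrite -[y]opprK; apply: (EB) => //; rewrite -sub0r; exact: EB.
have [r0 r0P] : exists r0 : R, forall n r, E (a *~ n, r) -> r = r0 *~ n.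
  have [[n [n0 [r Er]]]|H] := pselect (exists n : int, n != 0 /\ exists r, E (a *~ n, r)).
    exists (r / n%:~R) => m s Es.
    have := EB _ _ (additive_graph_mulz m gE Er) (additive_graph_mulz n gE Es).
    rewrite !pair_mulrz -!mulrzA [n * m]mulrC.
    rewrite pair_sub subrr.
    move=> /Ef/eqP; rewrite subr_eq0 => /eqP rs.
    by rewrite -mulrzl mulrA mulrzl rs -mulrzr mulfK// intr_eq0.
  exists 0 => n r Er; have n0 : n = 0.
    by apply/eqP; apply: contrapT => /negP n0; apply: (H); exists n; split=> //; exists r.
  by move: Er; rewrite n0 !mulr0z; exact: Ef.
exists [set x | exists k : int, exists2 y, E y & x = y + (a, r0) *~ k]; split.
- split.
  + by exists 0, 0 => //; rewrite mulr0z addr0.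
  + move=> _ _ [k [y Ey ->]] [l [z Ez ->]]; exists (k - l), (y - z); first exact: EB.
    by rewrite mulrzBr opprD addrACA.
  + move=> r [k [[b s] Ey]]; rewrite pair_mulrz => -[/esym/eqP].
    rewrite addr_eq0 => /eqP bE ->; move: Ey; rewrite bE -mulrNz => /r0P ->.
    by rewrite mulrNz addNr.
- by move=> x Ex; exists 0, x => //; rewrite mulr0z addr0.
- by exists r0; exists 1, 0 => //; rewrite add0r.
Qed.

Lemma additive_extension E : additive_graph E ->
  exists h : {additive A -> R}, forall a r, E (a, r) -> h a = r.
Proof.
move=> gE.
(* The condition is put on the union with [E] because the empty chain, with empty union, must
   satisfy it too. *)
have [|X [gX Xmax]] := @Zorn_bigcup (A * R)%type
    [set X | additive_graph (X `|` E)].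
  move=> F FP Ftot; have [E0 EB Ef] := gE; split.
  - by right.
  - move=> x y [[X FX Xx]|Ex] [[Y FY Yy]|Ey].
    + have [XY|YX] := Ftot _ _ FX FY.
        have [_ YB _] := FP _ FY; have [||?|?] := YB x y;
          [by left; exact: XY|by left|by left; exists Y|by right].
      have [_ XB _] := FP _ FX; have [||?|?] := XB x y;
        [by left|by left; exact: YX|by left; exists X|by right].
    + have [_ XB _] := FP _ FX; have [||?|?] := XB x y;
        [by left|by right|by left; exists X|by right].
    + have [_ YB _] := FP _ FY; have [||?|?] := YB x y;
        [by right|by left|by left; exists Y|by right].
    + by right; exact: EB.
  - by move=> r [[X FX Xr]|/Ef//]; have [_ _] := FP _ FX; apply; left.
pose H := X `|` E.
have tot a : exists r, H (a, r).
  have [E' [gE' HE' [r E'r]]] := additive_graph_extend a gX.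
  exists r; apply: contrapT => nH.
  apply: (Xmax E').
    split; first by move=> x Xx; apply: HE'; left.
    by move=> E'X; apply: nH; left; exact: E'X.
  by rewrite /= (_ : E' `|` E = E')//; apply/setUidl => x Ex; apply: HE'; right.
have [H0 Hsub Hf] := gX.
have [h hP] := choice tot.
have huniq a r : H (a, r) -> h a = r.
  move=> Har; apply/eqP; rewrite -subr_eq0; apply/eqP; apply: Hf.
  by rewrite -(subrr a) -pair_sub; apply: (Hsub) => //; exact: hP.
have hB : zmod_morphism h.
  by move=> a b; apply: huniq; exact: (Hsub _ _ (hP a) (hP b)).
pose hA := GRing.isZmodMorphism.Build A R h hB.
by exists (HB.pack_for {additive A -> R} h hA) => a r Ear /=; apply: huniq; right.
Qed.

End AdditiveExtension.

(** * Separation, divisibility and one-parameter subgroups *)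

Section CompactDuality.
Context {R : realType} {G : topologicalZmodType}.
Context (cG : compact [set: G]) (hG : hausdorff_space G).

Lemma dual_separates (x y : G) :
  (forall chi : dual R G, ev chi x = ev chi y) -> x = y.
Proof.
move=> H; apply/eqP; rewrite -subr_eq0; apply: contrapT => /negP xy.
have [chi cchi] := @characters_separate R G (x - y) cG hG xy.
have := H (exist _ chi cchi); rewrite /ev/= => chixy.
have [cD _ _ _] := cchi.
have c0 : chi y != 0 by exact: (ev_neq0 (exist _ chi cchi) y).
by move=> /eqP; apply; apply: (mulIf c0); rewrite -cD subrK mul1r.
Qed.

(** Every cluster point of [f] at [t] has the same character values as [f t], hence equals it; in a
    compact group a unique cluster point is a limit. *)
Lemma dual_continuous (T : topologicalType) (f : T -> G) :
  (forall chi : dual R G, continuous (fun t => complex.Re (ev chi (f t))) /\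
     continuous (fun t => complex.Im (ev chi (f t)))) -> continuous f.
Proof.
move=> cf t; have [] := cG (F := f @ t); first exact: filterT.
move=> x [_ clx].
have sep (g : G -> R) y : continuous g -> continuous (g \o f) ->
    cluster (f @ t) y -> g y = g (f t).
  move=> cg cgf cly; apply/eqP; rewrite -subr_eq0 -normr_le0.
  apply/ler_addgt0Pr => e e0; rewrite add0r; have e2 : 0 < e / 2 by rewrite divr_gt0.
  have /cvgrPdist_lt/(_ _ e2) n1 := cg y.
  have /cvgrPdist_lt/(_ _ e2) n2 := cgf t.
  have [z [/= z1 z2]] := cly [set z | `|g (f t) - g z| < e / 2] _ n2 n1.
  move: z1 z2; rewrite !ltr_norml ler_norml => /andP[? ?] /andP[? ?].
  by apply/andP; split; lra.
have uniq y : cluster (f @ t) y -> y = f t.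
  move=> cly; apply: dual_separates => chi.
  have [cR cI] := ev_continuous chi; have [cfR cfI] := cf chi.
  have := sep _ _ cR cfR cly; have := sep _ _ cI cfI cly.
  by case: (ev chi y) (ev chi (f t)) => u v [u' v'] /= -> ->.
apply: (compact_cluster_set1 hG cG) => //; first exact: filterT.
- exact: filterT.
- apply/seteqP; split=> [y /uniq//|_ ->].
  by rewrite -(uniq _ clx).
Qed.

(** Dual to torsion-freeness: multiplication by [n] is injective on characters, so
    [chi *+ n |-> ev chi x] is a legitimate target for Kronecker's theorem. *)
Lemma compact_divisible n (x : G) : connected [set: G] -> (0 < n)%N ->
  exists y, y *+ n = x.
Proof.
move=> coG n0; have [M MM] := @invariant_mean R G.
pose rho (chi : dual R G) := chi *+ n.
have rhoB : zmod_morphism rho by move=> a b; rewrite /rho mulrnBl.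
pose rhoA := GRing.isZmodMorphism.Build _ _ rho rhoB.
have [|||y yP] := @kronecker R G cG (dual R G)
  (HB.pack_for {additive dual R G -> dual R G} rho rhoA) (ev^~ x) _ _ _ M MM.
- by move=> a b; rewrite ev_addl.
- by move=> a; exact: ev_norm.
- by move=> a /= /(dual_torsion_free coG n0) ->.
exists y; apply: dual_separates => chi.
by rewrite ev_mulrn_r -ev_mulrn_l; exact: yP.
Qed.

Lemma one_parameter_subgroup (h : {additive dual R G -> R}) :
  exists2 f : R^o -> G, ((forall s t, f (s + t) = f s + f t) /\ continuous f) &
    forall chi t, ev chi (f t) = Complex (trigo.cos (h chi * t)) (trigo.sin (h chi * t)).
Proof.
have [M MM] := @invariant_mean R G.
pose e (t : R) := Complex (trigo.cos t) (trigo.sin t).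
have eD s t : e (s + t) = e s * e t.
  by apply/eqP; rewrite eq_complex/= trigo.cosD trigo.sinD eqxx/= addrC.
have e1 t : e t * conjc (e t) = 1.
  apply/eqP; rewrite eq_complex/= mulrN opprK -!expr2 trigo.cos2Dsin2 eqxx/=.
  by rewrite mulrN addrC mulrC subrr.
have e0 : e 0 = 1 by rewrite /e trigo.cos0 trigo.sin0.
have /choice[f fP] : forall t : R^o, exists x, forall chi : dual R G, ev chi x = e (h chi * t).
  move=> t.
  have [|||x xP] := @kronecker R G cG (dual R G) (idfun : {additive dual R G -> dual R G})
    (fun chi => e (h chi * t)) _ _ _ M MM.
  - by move=> a b; rewrite raddfD mulrDl eD.
  - by move=> a; exact: e1.
  - by move=> a /= ->; rewrite raddf0 mul0r e0.
  by exists x => chi; exact: xP.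
exists f => //; split.
  move=> s t; apply: dual_separates => chi.
  by rewrite ev_addr !fP mulrDr eD.
apply: dual_continuous => chi; split=> t.
  have -> : (fun t => complex.Re (ev chi (f t))) = trigo.cos \o (fun t => h chi * t).
    by apply/funext => s; rewrite fP.
  apply: continuous_comp; last exact: trigo.continuous_cos.
  by apply: cvgM; [exact: cvg_cst|exact: cvg_id].
have -> : (fun t => complex.Im (ev chi (f t))) = trigo.sin \o (fun t => h chi * t).
  by apply/funext => s; rewrite fP.
apply: continuous_comp; last exact: trigo.continuous_sin.
by apply: cvgM; [exact: cvg_cst|exact: cvg_id].
Qed.

End CompactDuality.

(** * The rank of the dual *)

Section RankOne.
Local Notation R := Rdefinitions.R.
Context {G : topologicalZmodType}.
Context (cG : compact [set: G]) (hG : hausdorff_space G).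

(** If [chi] and [eta] were independent, there would be one-parameter subgroups [f1], [f2] with
    frequencies [(1, 0)] and [(0, 1)] on them. In dimension one [f1] is a rescaling of [f2], on
    which [chi] is trivial; but [chi] takes the value -1 at [f1 trigo.pi]. *)
Lemma dual_rank_one (chi eta : dual R G) : connected [set: G] -> dim_eq G 1 ->
  chi != 0 -> exists m n : int, n != 0 /\ eta *~ n = chi *~ m.
Proof.
move=> coG [b [bc bP]] chi0; apply: contrapT => H.
have indep k l : chi *~ k + eta *~ l = 0 -> k = 0 /\ l = 0.
  move=> kl; have l0 : l = 0.
    apply/eqP; apply: contrapT => /negP l0; apply: H; exists (- k), l; split=> //.
    by apply/eqP; rewrite mulrNz -addr_eq0 addrC kl.
  split=> //; move: kl; rewrite l0 mulr0z addr0 => ck; apply/eqP.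
  by apply: contrapT => /negP k0; move: chi0; rewrite (dual_torsion_free_int coG k0 ck) eqxx.
have hom (al be : R) : exists h : {additive dual R G -> R}, h chi = al /\ h eta = be.
  have [|h hP] := @additive_extension R (dual R G)
    [set x | exists k l : int, x = (chi *~ k + eta *~ l, al *~ k + be *~ l)].
    split.
    - by exists 0, 0; rewrite !mulr0z !addr0.
    - move=> _ _ [k [l ->]] [k' [l' ->]]; exists (k - k'), (l - l').
      by rewrite pair_sub !mulrzBr; congr (_, _); rewrite opprD addrACA.
    - move=> r [k [l E]]; have [k0 l0] := indep _ _ (esym (congr1 fst E)).
      by have /= -> := congr1 snd E; rewrite k0 l0 !mulr0z addr0.
  exists h; split; apply: hP.
    by exists 1, 0; rewrite !mulr0z !addr0.
  by exists 0, 1; rewrite !mulr0z !add0r.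
have [h1 [h1c h1e]] := hom 1 0; have [h2 [h2c h2e]] := hom 0 1.
have [f1 cf1 f1P] := one_parameter_subgroup cG hG h1.
have [f2 cf2 f2P] := one_parameter_subgroup cG hG h2.
have [c1 [c1E _]] := bP _ cf1; have [c2 [c2E _]] := bP _ cf2.
have f1E t : f1 t = b ord0 (c1 ord0 * t) by rewrite c1E big_ord1.
have f2E t : f2 t = b ord0 (c2 ord0 * t) by rewrite c2E big_ord1.
have cospi1 : Complex (trigo.cos trigo.pi) (trigo.sin trigo.pi) != 1 :> R[i].
  by rewrite eq_complex/= trigo.cospi; apply/negP => /andP[/eqP]; lra.
have c20 : c2 ord0 != 0.
  apply/eqP => c20; have := f2P eta trigo.pi; rewrite f2E c20 mul0r h2e mul1r.
  have -> : b ord0 0 = 0.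
    have [bD _] := bc ord0; have := bD 0 0.
    by rewrite addr0 => /eqP; rewrite -subr_eq0 opprD addrA subrr add0r oppr_eq0 => /eqP.
  by rewrite ev_0r => /esym/eqP; rewrite (negPf cospi1).
have := f1P chi trigo.pi; rewrite f1E h1c mul1r.
have -> : c1 ord0 * trigo.pi = c2 ord0 * ((c2 ord0)^-1 * c1 ord0 * trigo.pi).
  by rewrite mulrA mulVKf.
rewrite -f2E f2P h2c mul0r trigo.cos0 trigo.sin0 => /esym/eqP.
by rewrite (negPf cospi1).
Qed.

End RankOne.

(** * Continuous homomorphisms *)

Section ContinuousHom.

Lemma chomD (A B : topZmod) (f : A -> B) : is_chom f ->
  forall x y, f (x + y) = f x + f y.
Proof. by case. Qed.

Lemma chom0 (A B : topZmod) (f : A -> B) : is_chom f -> f 0 = 0.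
Proof.
by move=> cf; apply: (addIr (f 0)); rewrite -chomD// !add0r.
Qed.

Lemma chomN (A B : topZmod) (f : A -> B) x : is_chom f -> f (- x) = - f x.
Proof.
by move=> cf; apply/eqP; rewrite -addr_eq0 -chomD// addNr chom0.
Qed.

Lemma chomB (A B : topZmod) (f : A -> B) x y : is_chom f ->
  f (x - y) = f x - f y.
Proof. by move=> cf; rewrite chomD// chomN. Qed.

Lemma chomMn (A B : topZmod) (f : A -> B) x n : is_chom f ->
  f (x *+ n) = f x *+ n.
Proof.
move=> cf; elim: n => [|n IH]; first by rewrite !mulr0n chom0.
by rewrite !mulrS chomD// IH.
Qed.

Lemma chomMz (A B : topZmod) (f : A -> B) x (n : int) : is_chom f ->
  f (x *~ n) = f x *~ n.
Proof.
by move=> cf; case: n => n; rewrite ?NegzE ?mulrNz -?pmulrn ?chomN// chomMn.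
Qed.

Lemma chom_id (A : topZmod) : is_chom (@id A).
Proof. by split=> // x; exact: cvg_id. Qed.

Lemma chom_comp (A B C : topZmod) (f : A -> B) (g : B -> C) :
  is_chom f -> is_chom g -> is_chom (fun x => g (f x)).
Proof.
move=> [fD cf] [gD cg]; split=> [x y|x]; first by rewrite fD gD.
by apply: (@continuous_comp _ _ _ f g); [exact: cf|exact: cg].
Qed.

Lemma chom_zero (A B : topZmod) : is_chom (fun _ : A => 0 : B).
Proof. by split=> [x y|x]; [rewrite /= addr0|exact: cvg_cst]. Qed.

Lemma chom_add (A : topZmod) (B : topologicalZmodType) (f g : A -> B) :
  is_chom f -> is_chom g -> is_chom (fun x => f x + g x).
Proof.
move=> [fD cf] [gD cg]; split=> [x y|x]; first by rewrite fD gD addrACA.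
apply: (@continuous_comp _ _ _ (fun x => (f x, g x)) (fun z : B * B => z.1 + z.2)).
  by apply: (@cvg_pair _ _ _ _ (nbhs (f x)) (nbhs (g x))); [exact: cf|exact: cg].
exact: add_continuous.
Qed.

Lemma chom_opp (A : topZmod) (B : topologicalZmodType) (f : A -> B) :
  is_chom f -> is_chom (fun x => - f x).
Proof.
move=> [fD cf]; split=> [x y|x]; first by rewrite fD opprD.
by apply: (@continuous_comp _ _ _ f -%R); [exact: cf|exact: opp_continuous].
Qed.

Lemma chom_sub (A : topZmod) (B : topologicalZmodType) (f g : A -> B) :
  is_chom f -> is_chom g -> is_chom (fun x => f x - g x).
Proof. by move=> cf cg; apply: chom_add => //; exact: chom_opp. Qed.

Lemma chom_mulz (A : topZmod) (B : topologicalZmodType) (f : A -> B) (n : int) :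
  is_chom f -> is_chom (fun x => f x *~ n).
Proof.
move=> cf; have H m : is_chom (fun x => f x *+ m).
  elim: m => [|m IH]; first exact: chom_zero.
  by under eq_fun do rewrite mulrS; exact: chom_add.
case: n => n; first exact: H.
by under eq_fun do rewrite NegzE mulrNz; apply: chom_opp; exact: H.
Qed.

Lemma top_iso_refl (A : topZmod) : top_iso A A.
Proof. by exists id, id; do !split=> //; move=> x; exact: cvg_id. Qed.

Lemma top_iso_sym (A B : topZmod) : top_iso A B -> top_iso B A.
Proof. by move=> [f [g [cf [cg [fK gK]]]]]; exists g, f. Qed.

Lemma top_iso_trans (A B C : topZmod) :
  top_iso A B -> top_iso B C -> top_iso A C.
Proof.
move=> [f [g [cf [cg [fK gK]]]]] [f' [g' [cf' [cg' [fK' gK']]]]].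
exists (fun x => f' (f x)), (fun x => g (g' x)).
split; first exact: chom_comp.
split; first exact: chom_comp.
by split=> x; [rewrite fK' fK|rewrite gK gK'].
Qed.

End ContinuousHom.

Lemma gcdz_factor (m n : int) : n != 0 -> exists g a b : int,
  [/\ g != 0, m = a * g, n = b * g, b != 0 & coprimez a b].
Proof.
move=> n0; have g0 : gcdz m n != 0 by rewrite gcdz_eq0 negb_and n0 orbT.
have mE : m = (m %/ gcdz m n)%Z * gcdz m n by rewrite divzK ?dvdz_gcdl.
have nE : n = (n %/ gcdz m n)%Z * gcdz m n by rewrite divzK ?dvdz_gcdr.
exists (gcdz m n), (m %/ gcdz m n)%Z, (n %/ gcdz m n)%Z; split=> //.
  by apply: contra n0 => /eqP b0; rewrite nE b0 mul0r.
have [u [v uv]] := Bezoutz m n; apply/coprimezP; exists (u, v) => /=.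
by apply: (mulIf g0); rewrite mulrDl -!mulrA -mE -nE uv mul1r.
Qed.

(** * Solenoids *)

Section Solenoid.
Local Notation R := Rdefinitions.R.
Implicit Types S X : topologicalZmodType.

(** Were the basis element zero, the coordinate of the zero map would not be unique. *)
Lemma solenoid_one_parameter S : solenoid S ->
  exists2 b : R^o -> S, is_chom b & exists t, b t != 0.
Proof.
move=> [_ [b [cb bP]]]; exists (b ord0); first exact: cb.
apply: contrapT => /forallNP H.
have b0 t : b ord0 t = 0 by apply/eqP; apply: contrapT => /negP; exact: H.
have [c [_ cu]] := bP _ (chom_zero R^o S).
have E d : c = (fun=> d).
  by apply: cu; apply/funext => t; rewrite big_ord1 b0.
have := congr1 (fun h => h ord0) (etrans (esym (E 0)) (E 1)).
by move=> /esym/eqP; rewrite oner_eq0.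
Qed.

Lemma solenoid_nontrivial S : solenoid S -> exists x : S, x != 0.
Proof. by move=> /solenoid_one_parameter[b _ [t bt]]; exists (b t). Qed.

Lemma solenoid_divisible S n (x : S) : solenoid S -> (0 < n)%N ->
  exists y, y *+ n = x.
Proof. by move=> [[[cS hS] coS] _]; exact: (@compact_divisible R). Qed.

Lemma solenoid_divisible_int S (n : int) (x : S) : solenoid S -> n != 0 ->
  exists y, y *~ n = x.
Proof.
move=> sS; case: n => n n0.
  by apply: solenoid_divisible => //; case: n n0.
have [y yx] := @solenoid_divisible S n.+1 (- x) sS isT.
by exists y; rewrite NegzE mulrNz -pmulrn yx opprK.
Qed.

(** Divisibility of [S] makes the homomorphisms out of [S] torsion free; this is how integer factors
    are cancelled from identities between maps. *)
Lemma solenoid_hom_torsion_free S (X : topZmod) (f : S -> X) (n : int) :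
  solenoid S -> is_chom f -> n != 0 -> (forall x, f x *~ n = 0) ->
  forall x, f x = 0.
Proof.
move=> sS cf n0 fn x; have [y <-] := solenoid_divisible_int x sS n0.
by rewrite chomMz.
Qed.

Lemma character_neq0 S : solenoid S -> exists chi : dual R S, chi != 0.
Proof.
move=> sS; have [[[cS hS] _] _] := sS; have [x x0] := solenoid_nontrivial sS.
apply: contrapT => /forallNP H; move/eqP: x0; apply.
apply: (@dual_separates R _ cS hS) => chi; rewrite ev_0r.
have -> : chi = 0 by apply/eqP; apply: contrapT => /negP; exact: H.
by rewrite ev_0l.
Qed.

Lemma ev_prime_root S p (chi : dual R S) x : prime p -> x *+ p = 0 ->
  ev chi x != 1 -> p.-primitive_root (ev chi x).
Proof.
move=> pp xp cx; have up : ev chi x ^+ p = 1 by rewrite -ev_mulrn_r xp ev_0r.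
have [m pm mp] := prim_order_exists (prime_gt0 pp) up.
move: (pp) => /primeP[_ /(_ _ mp)] /orP[|] /eqP mE; last by rewrite -mE.
by move: cx; rewrite -(prim_expr_order pm) mE expr1 eqxx.
Qed.

(** Otherwise some nonzero [p]-torsion [w] is killed by a character [chi] with [ev chi x != 1],
    while some [eta] does not kill [w]. Rank one gives [eta *~ b = chi *~ a] with [a], [b] coprime;
    evaluating at [w] shows that [p] divides [b], and then evaluating at [x] that [p] divides
    [a]. *)
Lemma solenoid_torsion S p (x y : S) : solenoid S -> prime p ->
  x *+ p = 0 -> y *+ p = 0 -> x != 0 -> exists k, y = x *+ k.
Proof.
move=> sS pp xp yp x0; have [[[cS hS] coS] d1] := sS.
have [chi chix] : exists chi : dual R S, ev chi x != 1.
  apply: contrapT => /forallNP H; move/eqP: x0; apply.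
  apply: (@dual_separates R _ cS hS) => chi; rewrite ev_0r.
  by apply/eqP; apply: contrapT => /negP; exact: H.
have prx := ev_prime_root pp xp chix.
have yp1 : ev chi y ^+ p = 1 by rewrite -ev_mulrn_r yp ev_0r.
have [k chiy] := prim_rootP prx yp1.
exists k; apply/eqP; rewrite -subr_eq0; apply: contrapT => /negP yk.
set w := y - x *+ k in yk.
have wp : w *+ p = 0 by rewrite mulrnBl yp -mulrnA mulnC mulrnA xp mul0rn subrr.
have chiw : ev chi w = 1.
  by rewrite ev_addr ev_oppr ev_mulrn_r chiy -ev_mulrn_r ev_norm.
have [eta etaw] : exists eta : dual R S, ev eta w != 1.
  apply: contrapT => /forallNP H; move/eqP: yk; apply.
  apply: (@dual_separates R _ cS hS) => eta; rewrite ev_0r.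
  by apply/eqP; apply: contrapT => /negP; exact: H.
have prw := ev_prime_root pp wp etaw.
have chi0 : chi != 0 by apply: contra chix => /eqP->; rewrite ev_0l.
have [m [n [n0 nm]]] := dual_rank_one cS hS eta coS d1 chi0.
have [d [a [b [d0 mE nE b0 ab]]]] := gcdz_factor m n0.
have ba : eta *~ b = chi *~ a.
  apply/eqP; rewrite -subr_eq0; apply/eqP.
  apply: (dual_torsion_free_int coS d0).
  by rewrite mulrzBl -!mulrzA -mE -nE nm subrr.
have ev1 (kappa : dual R S) z (l : int) : ev kappa z = 1 -> ev kappa (z *~ l) = 1.
  case: l => l kz; rewrite ?NegzE ?mulrNz -?pmulrn ?ev_oppr ev_mulrn_r kz expr1n//.
  exact: conjc1.
have dvd (kappa : dual R S) z (l : int) : p.-primitive_root (ev kappa z) ->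
    ev kappa (z *~ l) = 1 -> (p %| `|l|)%N.
  move=> pz; case: l => l; rewrite ?NegzE ?mulrNz -?pmulrn ?ev_oppr ev_mulrn_r.
    by move=> /eqP; rewrite -(prim_order_dvd pz).
  move=> /(congr1 conjc); rewrite conjcK conjc1 => /eqP.
  by rewrite -(prim_order_dvd pz).
have pb : (p %| `|b|)%N.
  by apply: (dvd _ _ _ prw); rewrite -ev_mulrz ba ev_mulrz ev1.
have pa : (p %| `|a|)%N.
  apply: (dvd _ _ _ prx); rewrite -ev_mulrz -ba ev_mulrz.
  have [q ->] : exists q, b = q * p%:Z by apply/dvdzP; rewrite dvdzE.
  by rewrite mulrC mulrzA -pmulrn xp mul0rz ev_0r.
have : (p %| gcdn `|a| `|b|)%N by rewrite dvdn_gcd pa pb.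
move: ab; rewrite /coprimez /gcdz => /eqP[->]; rewrite dvdn1 => /eqP p1.
by move: pp; rewrite p1.
Qed.

Lemma dual_precomp S X (f : S -> X) (chi : dual R X) : is_chom f ->
  exists eta : dual R S, forall x, ev eta x = ev chi (f x).
Proof.
move=> [fD cf]; have [cR cI] := ev_continuous chi.
have c : is_character (fun x => ev chi (f x)).
  split=> [x y|x||].
  - by rewrite fD ev_addr.
  - exact: ev_norm.
  - by move=> x; apply: continuous_comp (cf x) (cR (f x)).
  - by move=> x; apply: continuous_comp (cf x) (cI (f x)).
by exists (exist _ _ c).
Qed.

(** Rank one gives integers with [f x *~ n - x *~ m] killed by one nonzero character. Every other
    character is a rational multiple of that one, so by divisibility it kills this difference as
    well. *)
Lemma solenoid_end_rational S (f : S -> S) : solenoid S -> is_chom f ->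
  exists a b : int, [/\ b != 0, coprimez a b & forall x, f x *~ b = x *~ a].
Proof.
move=> sS cf; have [[[cS hS] coS] d1] := sS.
have [chi chi0] := character_neq0 sS; have [eta etaE] := dual_precomp chi cf.
have [m [n [n0 nm]]] := dual_rank_one cS hS eta coS d1 chi0.
pose g x := f x *~ n - x *~ m.
have cg : is_chom g by apply: chom_sub; apply: chom_mulz => //; exact: chom_id.
have chig x : ev chi (g x) = 1.
  by rewrite ev_addr ev_oppr -(chomMz x n cf) -etaE -(ev_mulrz eta) nm ev_mulrz ev_norm.
have g0 x : g x = 0.
  apply: (@dual_separates R _ cS hS) => kappa; rewrite ev_0r.
  have [m' [n' [n'0 nm']]] := dual_rank_one cS hS kappa coS d1 chi0.
  have [y <-] := solenoid_divisible_int x sS n'0.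
  by rewrite chomMz// -ev_mulrz nm' ev_mulrz -chomMz.
have [d [a [b [d0 mE nE b0 ab]]]] := gcdz_factor m n0.
exists a, b; split=> //.
have cg' : is_chom (fun x => f x *~ b - x *~ a).
  by apply: chom_sub; apply: chom_mulz => //; exact: chom_id.
move=> x; apply/eqP; rewrite -subr_eq0; apply/eqP.
apply: (solenoid_hom_torsion_free sS cg' d0) => y.
by rewrite mulrzBl -!mulrzA -mE -nE; exact: g0.
Qed.

(** Preimages under multiplication by [p] are chosen arbitrarily, so continuity of the quotient map
    is not automatic; it holds because multiplication by [p] on a compact group is a closed map. *)
Lemma factor_through_mul S X (f : S -> X) p : solenoid S -> compact_group X ->
  is_chom f -> (0 < p)%N -> (forall x, x *+ p = 0 -> f x = 0) ->
  exists2 f' : S -> X, is_chom f' & forall x, f x = f' x *+ p.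
Proof.
move=> sS [cX hX] cf p0 fp; have [[[cS hS] coS] d1] := sS.
have /choice[d dp] : forall x : S, exists y, y *+ p = x.
  by move=> x; exact: solenoid_divisible.
pose f' x := f (d x).
have f'E x : f' (x *+ p) = f x.
  apply/eqP; rewrite -subr_eq0 /f' -(chomB _ _ cf); apply/eqP; apply: fp.
  by rewrite mulrnBl dp subrr.
have f'D x y : f' (x + y) = f' x + f' y.
  by rewrite -[in LHS](dp x) -[in LHS](dp y) -mulrnDl f'E chomD.
have cp : continuous (fun x : S => x *+ p) by case: (chom_mulz p (chom_id S)).
exists f'; last first.
  move=> x; rewrite -f'E; elim: (p) => [|n IH].
    by rewrite !mulr0n; apply: (addIr (f' 0)); rewrite -f'D !add0r.
  by rewrite !mulrS f'D IH.
split=> //; apply/continuous_closedP => C clC.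
have -> : f' @^-1` C = (fun x => x *+ p) @` (f @^-1` C).
  apply/seteqP; split=> [x Cx|_ [x Cx <-]]; last by rewrite /= f'E.
  by exists (d x).
apply: compact_closed => //; apply: continuous_compact.
  exact: continuous_subspaceT.
apply: (subclosed_compact _ cS) => //.
by apply: closed_comp clC => x _; case: cf => _; apply.
Qed.

(* If a prime [p] divides [n], then [f] or [g] kills the [p]-torsion, because the
   [p]-torsion of a solenoid has order at most [p]; that map is then divisible
   by [p], and one concludes by induction on [n]. *)
Lemma solenoid_iso_of_multiple S S' (f : S -> S') (g : S' -> S) (n : int) :
  solenoid S -> solenoid S' -> is_chom f -> is_chom g -> n != 0 ->
  (forall x, g (f x) = x *~ n) -> top_iso S S'.
Proof.
move=> sS sS'; have [[gS coS] _] := sS; have [[gS' coS'] _] := sS'.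
move: {2}`|n|%N (leqnn `|n|%N) => k.
elim: k f g n => [|k IH] f g n.
  by rewrite leqn0 absz_eq0 => /eqP-> _ _; rewrite eqxx.
move=> nk cf cg n0 gf.
(* The other composite acts as some rational [a / b]; comparing the two readings of [f (g (f z))]
   forces [a = n * b], since [f] is nonzero. *)
have fg y : f (g y) = y *~ n.
  have cfg : is_chom (fun y => f (g y)) by exact: chom_comp.
  have [a [b [b0 _ ab]]] := solenoid_end_rational sS' cfg.
  have [x x0] := solenoid_nontrivial sS.
  have ch : is_chom (fun x => f x *~ (n * b - a)) by exact: chom_mulz.
  have fz z : f z *~ (n * b - a) = 0.
  by rewrite mulrzBr -ab gf (chomMz _ _ cf) -mulrzA subrr.
  have anb : a = n * b.
    apply/eqP; rewrite eq_sym -subr_eq0; apply: contrapT => /negP nab.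
    have f0 := solenoid_hom_torsion_free sS cf nab fz.
    have gfz (z : S) : z *~ n = 0 by rewrite -gf f0 (chom0 cg).
    by move/eqP: x0; apply; exact: (solenoid_hom_torsion_free sS (chom_id S) n0 gfz).
  apply/eqP; rewrite -subr_eq0; apply/eqP.
  have ch' : is_chom (fun y => f (g y) - y *~ n).
    by apply: chom_sub => //; apply: chom_mulz; exact: chom_id.
  apply: (solenoid_hom_torsion_free sS' ch' b0) => z.
  by rewrite mulrzBl ab anb mulrzA subrr.
have [n1|n1] := leqP `|n|%N 1.
  have nn : n * n = 1.
    by move: n n0 n1 {nk gf fg} => [[|[|n]]|[|n]].
  exists f, (fun y => g y *~ n); split=> //; split; first exact: chom_mulz.
  split=> x; first by rewrite gf -mulrzA nn.
  by rewrite chomMz// fg -mulrzA nn.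
pose p := pdiv `|n|%N; have pp : prime p by exact: pdiv_prime.
have [n' nE] : exists n', n = n' * p%:Z.
  by apply/dvdzP; rewrite dvdzE/= pdiv_dvd.
have n'0 : n' != 0 by apply: contra n0; rewrite nE => /eqP->; rewrite mul0r.
have n'k : (`|n'| <= k)%N.
  rewrite -ltnS; apply: leq_trans nk; rewrite nE abszM/= ltn_Pmulr//.
    exact: prime_gt1.
  by rewrite absz_gt0.
have p0 : (p%:Z : int) != 0 by rewrite -lt0n prime_gt0.
have [kf|nkf] := pselect (forall x, x *+ p = 0 -> f x = 0).
  have [f' cf' f'E] := factor_through_mul sS gS' cf (prime_gt0 pp) kf.
  apply: (IH f' g n') => // x; apply/eqP; rewrite -subr_eq0; apply/eqP.
  have ch : is_chom (fun x => g (f' x) - x *~ n').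
    by apply: chom_sub; [exact: chom_comp|apply: chom_mulz; exact: chom_id].
  apply: (solenoid_hom_torsion_free sS ch p0) => z.
  by rewrite mulrzBl -mulrzA -nE -gf f'E chomMn// subrr.
have [kg|nkg] := pselect (forall x, x *+ p = 0 -> g x = 0).
  have [g' cg' g'E] := factor_through_mul sS' gS cg (prime_gt0 pp) kg.
  apply: (IH f g' n') => // x; apply/eqP; rewrite -subr_eq0; apply/eqP.
  have ch : is_chom (fun x => g' (f x) - x *~ n').
    by apply: chom_sub; [exact: chom_comp|apply: chom_mulz; exact: chom_id].
  apply: (solenoid_hom_torsion_free sS ch p0) => z.
  by rewrite mulrzBl -mulrzA -nE -gf g'E subrr.
have [x /not_implyP[xp fx]] : exists x, ~ (x *+ p = 0 -> f x = 0) by exact/existsNP.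
have [y /not_implyP[yp gy]] : exists y, ~ (y *+ p = 0 -> g y = 0) by exact/existsNP.
have fxp : f x *+ p = 0 by rewrite -chomMn// xp chom0.
have fx0 : f x != 0 by exact/eqP.
have [l yE] := solenoid_torsion sS' pp fxp yp fx0.
exfalso; apply: gy; rewrite yE chomMn// gf nE mulrC mulrzA -pmulrn xp.
by rewrite mul0rz mul0rn.
Qed.

End Solenoid.

(** * Binary products *)

Section ProductGroup.
Context (A B : topologicalZmodType).

Lemma prod_add_continuous :
  continuous (fun z : (A * B) * (A * B) => z.1 + z.2).
Proof.
move=> [[a b] [a' b']].
apply: (@cvg_pair _ _ _ _ (nbhs (a + a')) (nbhs (b + b'))).
  apply: (@cvg_comp _ _ _ (fun z : (A * B) * (A * B) => (z.1.1, z.2.1)) (fun z => z.1 + z.2)).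
    apply: (@cvg_pair _ _ _ _ (nbhs a) (nbhs a')).
      by apply: (@cvg_comp _ _ _ fst fst); exact: cvg_fst.
    by apply: (@cvg_comp _ _ _ snd fst); [exact: cvg_snd|exact: cvg_fst].
  exact: (add_continuous (a, a')).
apply: (@cvg_comp _ _ _ (fun z : (A * B) * (A * B) => (z.1.2, z.2.2)) (fun z => z.1 + z.2)).
  apply: (@cvg_pair _ _ _ _ (nbhs b) (nbhs b')).
    by apply: (@cvg_comp _ _ _ fst snd); [exact: cvg_fst|exact: cvg_snd].
  by apply: (@cvg_comp _ _ _ snd snd); exact: cvg_snd.
exact: (add_continuous (b, b')).
Qed.

Lemma prod_opp_continuous : continuous (-%R : (A * B)%type -> (A * B)%type).
Proof.
move=> [a b]; apply: (@cvg_pair _ _ _ _ (nbhs (- a)) (nbhs (- b))).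
  by apply: (@cvg_comp _ _ _ fst -%R); [exact: cvg_fst|exact: opp_continuous].
by apply: (@cvg_comp _ _ _ snd -%R); [exact: cvg_snd|exact: opp_continuous].
Qed.

End ProductGroup.

(* Not canonical: the library's instance for products of topological vector
   spaces already occupies this slot. *)
Definition tprod (A B : topologicalZmodType) :
    topologicalZmodType :=
  HB.pack_for topologicalZmodType (A * B)%type
    (PreTopologicalNmodule_isTopologicalNmodule.Build (A * B)%type (@prod_add_continuous A B))
    (TopologicalNmodule_isTopologicalZmodule.Build (A * B)%type (@prod_opp_continuous A B)).

Section ProductMaps.
Implicit Types A B C : topologicalZmodType.

Lemma chom_fst A B : is_chom (fst : tprod A B -> A).
Proof. by split=> // x; exact: cvg_fst. Qed.

Lemma chom_snd A B : is_chom (snd : tprod A B -> B).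
Proof. by split=> // x; exact: cvg_snd. Qed.

Lemma chom_pair (X : topZmod) A B (f : X -> A) (g : X -> B) :
  is_chom f -> is_chom g -> is_chom (fun x => (f x, g x) : tprod A B).
Proof.
move=> [fD cf] [gD cg]; split=> [x y|x]; first by rewrite fD gD.
by apply: (@cvg_pair _ _ _ _ (nbhs (f x)) (nbhs (g x))); [exact: cf|exact: cg].
Qed.

Lemma chom_inl A B : is_chom (fun x => (x, 0) : tprod A B).
Proof. by apply: chom_pair; [exact: chom_id|exact: chom_zero]. Qed.

Lemma chom_inr A B : is_chom (fun y => (0, y) : tprod A B).
Proof. by apply: chom_pair; [exact: chom_zero|exact: chom_id]. Qed.

Lemma pair_mulrz_prod A B (x : A) (y : B) (n : int) :
  ((x, y) : tprod A B) *~ n = (x *~ n, y *~ n).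
Proof.
have e1 := chomMz (x, y) n (chom_fst A B); have e2 := chomMz (x, y) n (chom_snd A B).
by rewrite [LHS]surjective_pairing e1 e2.
Qed.

Lemma top_iso_prodr A B C : top_iso A B -> top_iso (tprod C A) (tprod C B).
Proof.
move=> [f [g [cf [cg [fK gK]]]]].
exists (fun z => (z.1, f z.2)), (fun z => (z.1, g z.2)).
split; first by apply: chom_pair; [exact: chom_fst|exact: chom_comp (chom_snd _ _) cf].
split; first by apply: chom_pair; [exact: chom_fst|exact: chom_comp (chom_snd _ _) cg].
by split=> -[x y] /=; rewrite ?fK ?gK.
Qed.

Lemma top_iso_prodl A B C : top_iso A B -> top_iso (tprod A C) (tprod B C).
Proof.
move=> [f [g [cf [cg [fK gK]]]]].
exists (fun z => (f z.1, z.2)), (fun z => (g z.1, z.2)).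
split; first by apply: chom_pair; [exact: chom_comp (chom_fst _ _) cf|exact: chom_snd].
split; first by apply: chom_pair; [exact: chom_comp (chom_fst _ _) cg|exact: chom_snd].
by split=> -[x y] /=; rewrite ?fK ?gK.
Qed.

Lemma top_iso_prodCA A B C : top_iso (tprod A (tprod B C)) (tprod B (tprod A C)).
Proof.
have H A' B' C' : is_chom (fun z : tprod A' (tprod B' C') =>
    (z.2.1, (z.1, z.2.2)) : tprod B' (tprod A' C')).
  apply: chom_pair; first exact: chom_comp (chom_snd _ _) (chom_fst _ _).
  apply: chom_pair; first exact: chom_fst.
  exact: chom_comp (chom_snd _ _) (chom_snd _ _).
exists (fun z => (z.2.1, (z.1, z.2.2))), (fun z => (z.2.1, (z.1, z.2.2))).
by split; [exact: H|split; [exact: H|split=> -[x [y t]]]].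
Qed.

End ProductMaps.

(** * Kernels and split maps *)

Section Kernel.
Context (K S : topologicalZmodType) (g : K -> S).

(** The proof [cg] is a parameter of the type so that the group structure, which depends on it, can
    be attached as an instance. *)
Definition kernel (cg : is_chom g) := {x : K | g x = 0}.

Context (cg : is_chom g).
Local Notation ker := (kernel cg).

HB.instance Definition _ := gen_eqMixin ker.
HB.instance Definition _ := gen_choiceMixin ker.
HB.instance Definition _ := Topological.copy ker
  (initial_topology (@sval K (fun x => g x = 0) : ker -> K)).

Lemma kernel_ext (x y : ker) : sval x = sval y -> x = y.
Proof. by case: x y => [x gx] [y gy] /= xy; exact: eq_exist. Qed.

Lemma kernel_zeroP : g 0 = 0. Proof. exact: chom0. Qed.
Lemma kernel_addP (x y : ker) : g (sval x + sval y) = 0.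
Proof. by rewrite (chomD cg) (svalP x) (svalP y) addr0. Qed.
Lemma kernel_oppP (x : ker) : g (- sval x) = 0.
Proof. by rewrite (chomN _ cg) (svalP x) oppr0. Qed.

Definition kernel_zero : ker := exist _ _ kernel_zeroP.
Definition kernel_add (x y : ker) : ker := exist _ _ (kernel_addP x y).
Definition kernel_opp (x : ker) : ker := exist _ _ (kernel_oppP x).

Lemma kernel_addA : associative kernel_add.
Proof. by move=> x y z; apply: kernel_ext; exact: addrA. Qed.
Lemma kernel_addC : commutative kernel_add.
Proof. by move=> x y; apply: kernel_ext; exact: addrC. Qed.
Lemma kernel_add0 : left_id kernel_zero kernel_add.
Proof. by move=> x; apply: kernel_ext; exact: add0r. Qed.
Lemma kernel_addN : left_inverse kernel_zero kernel_opp kernel_add.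
Proof. by move=> x; apply: kernel_ext; exact: addNr. Qed.

HB.instance Definition _ :=
  GRing.isZmodule.Build ker kernel_addA kernel_addC kernel_add0 kernel_addN.

Lemma kernel_val_continuous : continuous (fun x : ker => sval x).
Proof. exact: (@initial_continuous _ _ (@sval K (fun x => g x = 0) : ker -> K)). Qed.

Lemma kernel_continuous (T : topologicalType) (f : T -> ker) :
  continuous (fun t => sval (f t)) -> continuous f.
Proof.
move=> /continuousP cf; apply/continuousP => U [V oV <-].
exact: cf V oV.
Qed.

Lemma kernel_add_continuous : continuous (fun z : ker * ker => z.1 + z.2).
Proof.
apply: kernel_continuous => -[x y].
apply: (@cvg_comp _ _ _ (fun z : ker * ker => (sval z.1, sval z.2)) (fun z => z.1 + z.2)).
  apply: (@cvg_pair _ _ _ _ (nbhs (sval x)) (nbhs (sval y))).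
    by apply: (@cvg_comp _ _ _ fst sval); [exact: cvg_fst|exact: kernel_val_continuous].
  by apply: (@cvg_comp _ _ _ snd sval); [exact: cvg_snd|exact: kernel_val_continuous].
exact: (add_continuous (sval x, sval y)).
Qed.

Lemma kernel_opp_continuous : continuous (-%R : ker -> ker).
Proof.
apply: kernel_continuous => x.
apply: (@cvg_comp _ _ _ sval -%R); first exact: kernel_val_continuous.
exact: opp_continuous.
Qed.

HB.instance Definition _ := PreTopologicalNmodule_isTopologicalNmodule.Build
  ker kernel_add_continuous.
HB.instance Definition _ := TopologicalNmodule_isTopologicalZmodule.Build
  ker kernel_opp_continuous.

Lemma top_iso_split (f : S -> K) : is_chom f -> (forall x, g (f x) = x) ->
  top_iso K (tprod S ker).
Proof.
move=> cf gf.
have gP x : g (x - f (g x)) = 0 by rewrite (chomB _ _ cg) gf subrr.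
have ch : is_chom (fun x => exist _ _ (gP x) : ker).
  split=> [x y|]; first by apply: kernel_ext; rewrite /= (chomD cg) (chomD cf) opprD addrACA.
  apply: kernel_continuous => /=.
  by case: (chom_sub (chom_id K) (chom_comp cg cf)).
exists (fun x => (g x, exist _ _ (gP x) : ker)), (fun z => f z.1 + sval z.2).
split; first exact: chom_pair.
split.
  apply: chom_add; first exact: chom_comp (chom_fst _ _) cf.
  apply: chom_comp (chom_snd _ _) _; split=> //; exact: kernel_val_continuous.
split=> [x|[x [y gy]]] /=; first by rewrite addrC subrK.
congr (_, _); first by rewrite (chomD cg) gf gy addr0.
by apply: kernel_ext => /=; rewrite (chomD cg) gf gy addr0 addrC addKr.
Qed.

End Kernel.

(** * Cancellation and decompositions *)

Section Cancellation.
Implicit Types S L K : topologicalZmodType.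

Lemma solenoid_faithful S (n : int) : solenoid S -> (forall x : S, x *~ n = 0) ->
  n = 0.
Proof.
move=> sS nx; have [x x0] := solenoid_nontrivial sS.
apply/eqP; apply: contrapT => /negP n0; move/eqP: x0; apply.
exact: (solenoid_hom_torsion_free sS (chom_id S) n0 nx).
Qed.

Lemma solenoid_int_inj S (m n : int) : solenoid S ->
  (forall x : S, x *~ m = x *~ n) -> m = n.
Proof.
move=> sS mn; apply/eqP; rewrite -subr_eq0; apply/eqP.
by apply: (solenoid_faithful sS) => x; rewrite mulrzBr mn subrr.
Qed.

(* [e] is invertible in the localization of [End S] at [p]. *)
Definition local_unit (p : nat) S (e : S -> S) := exists (g : S -> S) (m : int),
  [/\ is_chom g, ~~ (p %| m)%Z, forall x, e (g x) = x *~ m &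
      forall x, g (e x) = x *~ m].

Lemma prime_dvdz_mul p (m n : int) : prime p ->
  (p %| m * n)%Z = (p %| m)%Z || (p %| n)%Z.
Proof. by move=> pp; rewrite !dvdzE abszM /= Euclid_dvdM. Qed.

Lemma coprimez_prime p (m n : int) : prime p -> coprimez m n ->
  (p %| m)%Z -> ~~ (p %| n)%Z.
Proof.
move=> pp mn pm; apply/negP => pn.
have : (p %| gcdz m n)%Z by rewrite dvdz_gcd pm pn.
move: mn; rewrite /coprimez => /eqP->; rewrite dvdzE /= dvdn1 => /eqP p1.
by move: pp; rewrite p1.
Qed.

Lemma local_unit_numerator (p : nat) S (e : S -> S) (a b : int) : is_chom e ->
  ~~ (p %| a)%Z -> (forall x, e x *~ b = x *~ a) -> local_unit p e.
Proof.
move=> ce pa eab; exists (fun x => x *~ b), a; split=> //.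
- exact: chom_mulz (chom_id S).
- by move=> x; rewrite (chomMz _ _ ce).
Qed.

(* A denominator [b] in lowest terms is invertible in [End S]. *)
Lemma solenoid_denominator_unit S (e : S -> S) (a b : int) : is_chom e ->
  coprimez a b -> (forall x, e x *~ b = x *~ a) ->
  exists beta : S -> S, [/\ is_chom beta, forall x, beta x *~ b = x &
    forall x, e x = beta x *~ a].
Proof.
move=> ce ab eab; have [[u v] /= uv] := coprimezP _ _ ab.
(* With [a * u + b * v = 1] the endomorphism [u e + v], where [e = a / b], is [1 / b]. *)
have bb x : (e x *~ u + x *~ v) *~ b = x.
  by rewrite mulrzDl -!mulrzA [u * b]mulrC [e x *~ _]mulrzA eab -mulrzA [a * u]mulrC -mulrzDr uv.
exists (fun x => e x *~ u + x *~ v); split=> //.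
  by apply: chom_add; apply: chom_mulz => //; exact: chom_id.
move=> x; rewrite -[in LHS](bb x) (chomMz _ _ ce) eab; congr (_ *~ a).
Qed.

(** When [p] is invertible in [End S], localizing at [p] inverts all primes, so every nonzero
    endomorphism becomes a unit: the power of [p] in its numerator is absorbed by iterating [pi]. *)
Lemma local_unit_p_divisible p S (e pi : S -> S) : solenoid S -> prime p ->
  is_chom e -> is_chom pi -> (forall x, pi x *+ p = x) ->
  (exists x, e x != 0) -> local_unit p e.
Proof.
move=> sS pp ce cpi piE [x0 ex0].
have [a [b [b0 ab eab]]] := solenoid_end_rational sS ce.
have a0 : a != 0.
  apply: contra ex0 => /eqP a0; apply/eqP.
  apply: (solenoid_hom_torsion_free sS ce b0) => x.
  by rewrite eab a0 mulr0z.
have [j [a' [aE pa']]] : exists j (a' : int), a = a' * (p ^ j)%N%:Z /\ ~~ (p %| a')%Z.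
  have pdv : (p ^ logn p `|a| %| `|a|)%N by exact: pfactor_dvdnn.
  have [a' aE] : exists a', a = a' * (p ^ logn p `|a|)%N%:Z by apply/dvdzP; rewrite dvdzE.
  exists (logn p `|a|), a'; split=> //; rewrite dvdzE /=; apply/negP => pa'.
  have /(congr1 absz) := aE; rewrite abszM /= => aE'.
  have : (p ^ (logn p `|a|).+1 %| `|a|)%N by rewrite {2}aE' expnS dvdn_mul.
  by rewrite pfactor_dvdn// ?absz_gt0// ltnn.
have [pij [cpij pijE]] : exists pij : S -> S, is_chom pij /\ forall x, pij x *+ (p ^ j) = x.
  elim: (j) => [|i [f [cf fE]]]; first by exists id; split=> //; exact: chom_id.
  exists (fun x => pi (f x)); split; first exact: chom_comp.
  by move=> x; rewrite expnS mulrnA piE fE.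
exists (fun x => pij x *~ b), a'; split=> //; first exact: chom_mulz.
- move=> x; rewrite (chomMz _ _ ce) eab aE mulrC mulrzA -pmulrn.
  by rewrite pijE.
- move=> x; rewrite -(chomMz _ _ cpij) eab aE (chomMz _ _ cpij) mulrC mulrzA -pmulrn.
  by rewrite pijE.
Qed.

(** Suppose [p] divides the numerators of both [e] and [n - e h]. If it does not divide the
    denominator of [h], it would divide [n]; if it does, it is invertible in [End S], and a nonzero
    [e] is a unit, while for [e = 0] the other map is [n]. *)
Lemma solenoid_end_local (p : nat) S (e h : S -> S) (n : int) : solenoid S -> prime p ->
  is_chom e -> is_chom h -> ~~ (p %| n)%Z ->
  local_unit p e \/ local_unit p (fun x => x *~ n - e (h x)).
Proof.
move=> sS pp ce ch pn; set k := fun x => _.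
have ck : is_chom k.
  by apply: chom_sub; [apply: chom_mulz; exact: chom_id|exact: chom_comp].
have [a [b [b0 ab eab]]] := solenoid_end_rational sS ce.
have [pa|pa] := boolP (p %| a)%Z; last by left; exact: local_unit_numerator eab.
have [c [d [d0 cd kcd]]] := solenoid_end_rational sS ck.
have [pc|pc] := boolP (p %| c)%Z; last by right; exact: local_unit_numerator kcd.
have [u [v [v0 uv huv]]] := solenoid_end_rational sS ch.
(* This is [n = c / d + (a / b) * (u / v)] cleared of denominators; read modulo [p], it gives the
   contradiction at the end. *)
have eqn : n * (b * d * v) = c * (b * v) + a * u * d.
  apply: (solenoid_int_inj sS) => x.
  have kx : x *~ n = k x + e (h x) by rewrite /k subrK.
  have e1 : k x *~ (b * d * v) = x *~ (c * (b * v)).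
    by rewrite (_ : b * d * v = d * (b * v)) ?mulrzA ?kcd -?mulrzA//; ring.
  have e2 : e (h x) *~ (b * d * v) = x *~ (a * u * d).
    rewrite (_ : b * d * v = b * v * d); last by ring.
    by rewrite !mulrzA eab [h x *~ a *~ v]mulrzAC huv [x *~ u *~ a]mulrzAC.
  by rewrite mulrzA kx mulrzDl e1 e2 mulrzDr.
have [pv|pv] := boolP (p %| v)%Z.
  have [beta [cb bE _]] := solenoid_denominator_unit ch uv huv.
  have [v' vE] : exists v', v = v' * p%:Z by apply/dvdzP.
  have cpi : is_chom (fun x => beta x *~ v') by exact: chom_mulz.
  have piE x : (beta x *~ v') *+ p = x by rewrite pmulrn -mulrzA -vE bE.
  have [ex|ex] := pselect (exists x, e x != 0).
    by left; exact: local_unit_p_divisible piE ex.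
  right; have kn x : k x *~ 1 = x *~ n.
    have -> : k x = x *~ n; last by [].
    rewrite /k; have -> : e (h x) = 0; last by rewrite subr0.
    by apply/eqP; apply: contrapT => /negP ehx; apply: ex; exists (h x).
  exact: local_unit_numerator kn.
exfalso; have : (p %| n * (b * d * v))%Z.
  rewrite eqn; apply: rpredD; first exact: dvdz_mulr.
  by rewrite -mulrA; exact: dvdz_mulr.
rewrite !prime_dvdz_mul// (negPf pn) (negPf pv) (negPf (coprimez_prime pp ab pa)).
by rewrite (negPf (coprimez_prime pp cd pc)).
Qed.

Definition nearly_iso_at p K L := exists (phi : K -> L) (psi : L -> K) (n : int),
  is_chom phi /\ is_chom psi /\ coprime p `|n|%N /\
  (forall y : L, phi (psi y) = y *~ n) /\ (forall x : K, psi (phi x) = x *~ n).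

(* Schur complement of the corner [x |-> (phi (x, 0)).1]. *)
Lemma cancel_local_unit (p : nat) S L L' (phi : tprod S L -> tprod S L')
    (psi : tprod S L' -> tprod S L) (n : int) : prime p ->
  is_chom phi -> is_chom psi -> ~~ (p %| n)%Z ->
  (forall y, phi (psi y) = y *~ n) -> (forall x, psi (phi x) = x *~ n) ->
  local_unit p (fun x => (phi (x, 0)).1) -> nearly_iso_at p L L'.
Proof.
move=> pp cphi cpsi pn phipsi psiphi [g [m [cg pm ag ga]]].
pose a x := (phi (x, 0)).1; pose b y := (phi (0, y)).1.
pose c x := (phi (x, 0)).2; pose d y := (phi (0, y)).2.
pose b' y := (psi (0, y)).1; pose d' y := (psi (0, y)).2.
pose c' x := (psi (x, 0)).2.
have ca : is_chom a.
  exact: (@chom_comp S (tprod S L') S _ fst (chom_comp (chom_inl S L) cphi) (chom_fst _ _)).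
have cb : is_chom b.
  exact: (@chom_comp L (tprod S L') S _ fst (chom_comp (chom_inr S L) cphi) (chom_fst _ _)).
have cc : is_chom c.
  exact: (@chom_comp S (tprod S L') L' _ snd (chom_comp (chom_inl S L) cphi) (chom_snd _ _)).
have cd : is_chom d.
  exact: (@chom_comp L (tprod S L') L' _ snd (chom_comp (chom_inr S L) cphi) (chom_snd _ _)).
have cb' : is_chom b'.
  exact: (@chom_comp L' (tprod S L) S _ fst (chom_comp (chom_inr S L') cpsi) (chom_fst _ _)).
have cc' : is_chom c'.
  exact: (@chom_comp S (tprod S L) L _ snd (chom_comp (chom_inl S L') cpsi) (chom_snd _ _)).
have cd' : is_chom d'.
  exact: (@chom_comp L' (tprod S L) L _ snd (chom_comp (chom_inr S L') cpsi) (chom_snd _ _)).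
have phiE x y : phi (x, y) = (a x + b y, c x + d y).
  have -> : (x, y) = (x, 0) + (0, y) :> tprod S L by congr (_, _); rewrite ?addr0 ?add0r.
  by rewrite (chomD cphi) /a /b /c /d; case: (phi _) (phi _) => ? ? [].
have psi2E x y : (psi (x, y)).2 = c' x + d' y.
  have -> : (x, y) = (x, 0) + (0, y) :> tprod S L' by congr (_, _); rewrite ?addr0 ?add0r.
  by rewrite (chomD cpsi) /c' /d'; case: (psi _) (psi _) => ? ? [].
have psi0E y : psi (0, y) = (b' y, d' y) by rewrite /b' /d'; case: (psi _).
have e1 x : c' (a x) + d' (c x) = 0.
  have := congr1 snd (psiphi (x, 0)); rewrite phiE (chom0 cb) (chom0 cd) !addr0 psi2E.
  by rewrite pair_mulrz_prod /= mul0rz.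
have e2 y : c' (b y) + d' (d y) = y *~ n.
  have := congr1 snd (psiphi (0, y)); rewrite phiE (chom0 ca) (chom0 cc) !add0r psi2E.
  by rewrite pair_mulrz_prod.
have e3 y : a (b' y) + b (d' y) = 0.
  have := congr1 fst (phipsi (0, y)); rewrite psi0E phiE.
  by rewrite pair_mulrz_prod /= mul0rz.
have e4 y : c (b' y) + d (d' y) = y *~ n.
  have := congr1 snd (phipsi (0, y)); rewrite psi0E phiE.
  by rewrite pair_mulrz_prod.
(* The Schur complement [d - c a^-1 b], multiplied by [m] because the inverse of [a] is [g / m]. *)
exists (fun y => d y *~ m - c (g (b y))), d', (n * m); split.
  apply: chom_sub; first exact: chom_mulz.
  exact: chom_comp (chom_comp cb cg) cc.
split=> //; split.
  rewrite abszM coprimeMr !prime_coprime//.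
  by move: pn pm; rewrite !dvdzE /= => -> ->.
split=> [y|y].
  have -> : b (d' y) = - a (b' y) by apply/eqP; rewrite -addr_eq0 addrC e3.
  have -> : d (d' y) = y *~ n - c (b' y) by rewrite -e4 addrC addKr.
  rewrite (chomN _ cg) ga (chomN _ cc) opprK mulrzBl (chomMz _ _ cc).
  by rewrite subrK -mulrzA.
rewrite (chomB _ _ cd') (chomMz _ _ cd').
have -> : d' (c (g (b y))) = - c' (a (g (b y))).
  by apply/eqP; rewrite -addr_eq0 addrC e1.
rewrite [a _]ag (chomMz _ _ cc') opprK -mulrzDl addrC e2.
by rewrite -mulrzA.
Qed.

(* If the corner is not a local unit, composing with the automorphism
   [(x, y) |-> (x, y + c' x)] makes it one, by locality of [End S]. *)
Lemma cancel_solenoid p S L L' : solenoid S -> prime p ->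
  nearly_iso_at p (tprod S L) (tprod S L') -> nearly_iso_at p L L'.
Proof.
move=> sS pp [phi [psi [n [cphi [cpsi [pn [phipsi psiphi]]]]]]].
have {}pn : ~~ (p %| n)%Z by rewrite dvdzE /= -prime_coprime.
pose a x := (phi (x, 0)).1; pose b y := (phi (0, y)).1.
pose a' x := (psi (x, 0)).1; pose c' x := (psi (x, 0)).2.
have ca : is_chom a.
  exact: (@chom_comp S (tprod S L') S _ fst (chom_comp (chom_inl S L) cphi) (chom_fst _ _)).
have ca' : is_chom a'.
  exact: (@chom_comp S (tprod S L) S _ fst (chom_comp (chom_inl S L') cpsi) (chom_fst _ _)).
have cc' : is_chom c'.
  exact: (@chom_comp S (tprod S L) L _ snd (chom_comp (chom_inl S L') cpsi) (chom_snd _ _)).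
have phi1E x y : (phi (x, y)).1 = a x + b y.
  have -> : (x, y) = (x, 0) + (0, y) :> tprod S L by congr (_, _); rewrite ?addr0 ?add0r.
  by rewrite (chomD cphi) /a /b; case: (phi _) (phi _) => ? ? [].
have psi0E x : psi (x, 0) = (a' x, c' x) by rewrite /a' /c'; case: (psi _).
have e1 x : a (a' x) + b (c' x) = x *~ n.
  have := congr1 fst (phipsi (x, 0)); rewrite psi0E phi1E.
  by rewrite pair_mulrz_prod.
(* The new corner will be [a + b c'], which [e1] turns into [n - a (a' - 1)]. Locality is therefore
   applied to [a] and [a' - 1]. *)
have ch : is_chom (fun x => a' x - x) by apply: chom_sub => //; exact: chom_id.
have [ua|ua] := solenoid_end_local sS pp ca ch pn.
  exact: cancel_local_unit psiphi ua.
pose phi' (z : tprod S L) : tprod S L' := phi (z.1, z.2 + c' z.1).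
pose psi' (z : tprod S L') : tprod S L := ((psi z).1, (psi z).2 - c' (psi z).1).
have cphi' : is_chom phi'.
  apply: chom_comp _ cphi; apply: chom_pair; first exact: chom_fst.
  by apply: chom_add; [exact: chom_snd|exact: chom_comp (chom_fst _ _) cc'].
have cpsi' : is_chom psi'.
  apply: chom_pair; first exact: chom_comp cpsi (chom_fst _ _).
  apply: chom_sub; first exact: chom_comp cpsi (chom_snd _ _).
  exact: chom_comp (chom_comp cpsi (chom_fst _ _)) cc'.
apply: (@cancel_local_unit p S L L' phi' psi' n) => //.
- by move=> y; rewrite /phi' /psi' /= subrK -surjective_pairing phipsi.
- move=> [x y]; rewrite /phi' /psi' /= psiphi !pair_mulrz_prod /=; congr (_, _).
  by rewrite mulrzDl (chomMz _ _ cc') addrK.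
- have -> : (fun x => (phi' (x, 0)).1) = (fun x => x *~ n - a (a' x - x)).
    apply/funext => x; rewrite /phi' /= add0r phi1E (chomB _ _ ca) -e1 opprB.
    by rewrite [RHS]addrC addrA subrK.
  exact: ua.
Qed.

End Cancellation.

(** * Factoring multiples of the identity and matching the factors *)

Section Factorization.
Implicit Types S L K : topologicalZmodType.

Definition factors_through S K (n : int) := exists (f : S -> K) (g : K -> S),
  [/\ is_chom f, is_chom g & forall x, g (f x) = x *~ n].

(* [v] is the least positive integer multiple of the identity of [S] that
   factors through [K]; gcd combinations of factorizations show that [v] divides
   every composite [S -> K -> S] of the kinds below in [End S]. *)
Section Minimal.
Context S K (sS : solenoid S) (v : nat) (v0 : (0 < v)%N).
Context (vmin : forall n : nat, (0 < n)%N -> factors_through S K n -> (v <= n)%N).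

Let gcd_dvd (a : int) : factors_through S K (gcdz v a) -> (v %| a)%Z.
Proof.
move=> fa; have vn0 : v%:Z != 0 by rewrite -lt0n.
have g0 : (0 < `|gcdz v a|)%N by rewrite absz_gt0 gcdz_eq0 negb_and vn0.
have gE : gcdz v a = `|gcdz v a|%N by rewrite /gcdz.
have le : (v <= `|gcdz v a|)%N by apply: vmin => //; rewrite -gE.
have : (`|gcdz v a| %| v)%N by have := dvdz_gcdl v a; rewrite dvdzE.
move=> /(dvdn_leq v0) ge.
have gv : `|gcdz v a|%N = v by apply/eqP; rewrite eqn_leq ge le.
by have := dvdz_gcdr v a; rewrite gE gv.
Qed.

Lemma minimal_dvd_right (f1 f2 : S -> K) (g : K -> S) : is_chom f1 ->
  is_chom f2 -> is_chom g -> (forall x, g (f1 x) = x *~ v) ->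
  exists2 c : S -> S, is_chom c & forall x, g (f2 x) = c x *~ v.
Proof.
move=> cf1 cf2 cg gf1; have ce : is_chom (fun x => g (f2 x)) by exact: chom_comp.
have [a [b [b0 ab eab]]] := solenoid_end_rational sS ce.
have [beta [cb _ bE]] := solenoid_denominator_unit ce ab eab.
have [s [t st]] := Bezoutz v a.
have /gcd_dvd/dvdzP[a' aE] : factors_through S K (gcdz v a).
  exists (fun x => f1 x *~ s + f2 x *~ (b * t)), g; split=> //.
    by apply: chom_add; exact: chom_mulz.
  move=> x; rewrite (chomD cg) !(chomMz _ _ cg) gf1 [g (f2 x) *~ _]mulrzA eab -!mulrzA -mulrzDr.
  by rewrite -st [v%:Z * s]mulrC [a * t]mulrC.
exists (fun x => beta x *~ a'); first exact: chom_mulz.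
by move=> x; rewrite bE aE mulrzA.
Qed.

Lemma minimal_dvd_left (f : S -> K) (g1 g2 : K -> S) : is_chom f ->
  is_chom g1 -> is_chom g2 -> (forall x, g1 (f x) = x *~ v) ->
  exists2 c : S -> S, is_chom c & forall x, g2 (f x) = c x *~ v.
Proof.
move=> cf cg1 cg2 gf1; have ce : is_chom (fun x => g2 (f x)) by exact: chom_comp.
have [a [b [b0 ab eab]]] := solenoid_end_rational sS ce.
have [beta [cb _ bE]] := solenoid_denominator_unit ce ab eab.
have [s [t st]] := Bezoutz v a.
have /gcd_dvd/dvdzP[a' aE] : factors_through S K (gcdz v a).
  exists f, (fun y => g1 y *~ s + g2 y *~ (b * t)); split=> //.
    by apply: chom_add; exact: chom_mulz.
  move=> x; rewrite gf1 [g2 (f x) *~ _]mulrzA eab -!mulrzA -mulrzDr.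
  by rewrite -st [v%:Z * s]mulrC [a * t]mulrC.
exists (fun x => beta x *~ a'); first exact: chom_mulz.
by move=> x; rewrite bE aE mulrzA.
Qed.

(** Correct [f2] and [g2] so that [f2'] is killed by [g1] and [g2'] kills [f1]. Then [h = g1 + g2']
    still composes with [f1] to [v], so [v] divides [h f2' = g2' f2'], which differs from [w] by a
    multiple of [v]. *)
Lemma minimal_dvd (w : int) : factors_through S K v -> factors_through S K w ->
  exists2 c : S -> S, is_chom c & forall x, x *~ w = c x *~ v.
Proof.
move=> [f1 [g1 [cf1 cg1 gf1]]] [f2 [g2 [cf2 cg2 gf2]]].
have [c cc cE] := minimal_dvd_right cf1 cf2 cg1 gf1.
have [d cd dE] := minimal_dvd_left cf1 cg1 cg2 gf1.
pose f2' x := f2 x - f1 (c x).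
have cf2' : is_chom f2' by apply: chom_sub => //; exact: chom_comp.
have g1f2' x : g1 (f2' x) = 0 by rewrite /f2' (chomB _ _ cg1) cE gf1 subrr.
pose g2' y := g2 y - d (g1 y).
have cg2' : is_chom g2' by apply: chom_sub => //; exact: chom_comp.
have g2'f1 x : g2' (f1 x) = 0 by rewrite /g2' dE gf1 (chomMz _ _ cd) subrr.
pose h y := g1 y + g2' y.
have chh : is_chom h by exact: chom_add.
have hf1 x : h (f1 x) = x *~ v by rewrite /h gf1 g2'f1 addr0.
have [k ck kE] := minimal_dvd_right cf1 cf2' chh hf1.
exists (fun x => k x + d (c x)); first by apply: chom_add => //; exact: chom_comp.
move=> x; rewrite mulrzDl -kE /h g1f2' add0r /g2' g1f2' (chom0 cd) subr0.
by rewrite /f2' (chomB _ _ cg2) gf2 dE subrK.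
Qed.

End Minimal.

(** If a prime [p] divided the minimal [v], then [v], and with it [p], would divide in [End S] some
    [w] coprime to [p]. By Bezout [p] would be invertible in [End S], and precomposing with its
    inverse would factor the smaller multiple [v / p]. *)
Lemma identity_factors S K : solenoid S ->
  (forall p, prime p -> exists2 n : int, coprime p `|n|%N & factors_through S K n) ->
  factors_through S K 1.
Proof.
move=> sS H.
have vN (n : int) : factors_through S K n -> factors_through S K `|n|%N.
  move=> [f [g [cf cg gf]]]; have [nE|nE] : `|n|%N = n :> int \/ `|n|%N = - n :> int.
  - by case: n {gf} => n; [left|right; rewrite NegzE opprK].
  - by rewrite nE; exists f, g.
  rewrite nE; exists f, (fun y => - g y); split=> //; first exact: chom_opp.
  by move=> x; rewrite gf mulrNz.
have ex : exists n, (0 < n)%N && `[< factors_through S K n%:Z >].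
  have [n n2 fn] := H 2%N isT; exists `|n|%N; apply/andP; split.
    by rewrite lt0n; apply: contraL n2 => /eqP->.
  by apply/asboolP; exact: vN.
case: (ex_minnP ex) => v /andP[v0 /asboolP fv] vmin0.
have vmin (n : nat) : (0 < n)%N -> factors_through S K n -> (v <= n)%N.
  by move=> n0 fn; apply: vmin0; rewrite n0; exact/asboolP.
have [v1|v1] := leqP v 1.
  have vE : v = 1%N by case: v v0 v1 {fv vmin vmin0} => [|[]].
  by rewrite vE in fv.
pose p := pdiv v; have pp : prime p by exact: pdiv_prime.
have [v' vE] : exists v', v = (v' * p)%N by apply/dvdnP; exact: pdiv_dvd.
have v'0 : (0 < v')%N by move: v0; rewrite vE muln_gt0 => /andP[].
have [w pw fw] := H p pp.
have [c cc cE] := minimal_dvd sS v0 vmin fv fw.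
have [[s t] /= st] : exists uv : int * int, uv.1 * p + uv.2 * w = 1.
  by apply/coprimezP; rewrite /coprimez /gcdz /= -/(coprime p `|w|).
pose pi x := x *~ s + c x *~ (v'%:Z * t).
have cpi : is_chom pi.
  by apply: chom_add; apply: chom_mulz => //; exact: chom_id.
have piE x : pi x *~ p = x.
  rewrite /pi mulrzDl -!mulrzA (_ : v'%:Z * t * p%:Z = v%:Z * t); last by rewrite vE PoszM; ring.
  by rewrite [c x *~ _]mulrzA -cE -mulrzA -mulrzDr [w * t]mulrC st.
have : factors_through S K v'.
  have [f [g [cf cg gf]]] := fv; exists (fun x => f (pi x)), g; split=> //.
    exact: chom_comp.
  by move=> x; rewrite gf vE PoszM mulrC mulrzA piE.
move=> /(vmin _ v'0); rewrite vE leqNgt ltn_Pmulr// prime_gt1//.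
Qed.

Lemma clipped_not_factor S K : solenoid S -> clipped K -> ~ factors_through S K 1.
Proof.
move=> sS [_ nK] [f [g [cf cg gf]]]; apply: nK.
exists S, (kernel cg); split=> //.
exact: (top_iso_split cg cf).
Qed.

Fixpoint solenoid_list (l : seq topologicalZmodType) : Prop :=
  if l is X :: l' then solenoid X /\ solenoid_list l' else True.

Definition prod_list K (l : seq topologicalZmodType) : topologicalZmodType :=
  foldr tprod K l.

Lemma solenoid_list_cat l1 l2 :
  solenoid_list (l1 ++ l2) <-> solenoid_list l1 /\ solenoid_list l2.
Proof. by elim: l1 => [|S l1 IH] /=; tauto. Qed.

Lemma prod_list_move K l1 S l2 :
  top_iso (prod_list K (l1 ++ S :: l2)) (tprod S (prod_list K (l1 ++ l2))).
Proof.
elim: l1 => [|S1 l1 IH]; first exact: top_iso_refl.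
exact: top_iso_trans (top_iso_prodr S1 IH) (top_iso_prodCA _ _ _).
Qed.

(** The composite of [S] through a head [S'] not isomorphic to it must vanish, so the whole multiple
    of the identity already factors through the tail; at the end only [K] is left. *)
Lemma factor_in_list S l K : solenoid S -> solenoid_list l -> clipped K ->
  (forall p, prime p ->
     exists2 n : int, coprime p `|n|%N & factors_through S (prod_list K l) n) ->
  exists l1 S' l2, l = l1 ++ S' :: l2 /\ top_iso S S'.
Proof.
move=> sS + cK; elim: l => [_|S' l IH [sS' sl]] H.
  by case: (clipped_not_factor sS cK); exact: identity_factors.
have [iso|niso] := pselect (top_iso S S'); first by exists [::], S', l.
have [||l1 [S'' [l2 [-> iso]]]] := IH _ _ => //; last by exists (S' :: l1), S'', l2.
move=> p pp; have [n pn [f [g [cf cg gf]]]] := H p pp; exists n => //.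
pose f1 x := (f x).1; pose g1 y := g (y, 0).
pose f2 x := (f x).2; pose g2 y := g (0, y).
have cf1 : is_chom f1 by exact: chom_comp cf (chom_fst _ _).
have cf2 : is_chom f2 by exact: chom_comp cf (chom_snd _ _).
have cg1 : is_chom g1 by exact: chom_comp (chom_inl _ _) cg.
have cg2 : is_chom g2 by exact: chom_comp (chom_inr _ _) cg.
have ce : is_chom (fun x => g1 (f1 x)) by exact: chom_comp.
have sumE x : g1 (f1 x) + g2 (f2 x) = x *~ n.
  rewrite /g1 /g2 -(chomD cg) -gf; congr g.
  rewrite [RHS]surjective_pairing; congr (_, _); first exact: addr0.
  exact: add0r.
have [a [b [b0 ab eab]]] := solenoid_end_rational sS ce.
have [a0|a0] := eqVneq a 0; last first.
  (* Multiplying by the denominator [b] turns the rational [a / b] into a nonzero integer multiple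
     of the identity. *)
  case: niso; apply: (@solenoid_iso_of_multiple S S' f1 (fun y => g1 y *~ b) a) => //.
  exact: chom_mulz.
exists f2, g2; split=> // x; rewrite -sumE.
have -> : g1 (f1 x) = 0; last by rewrite add0r.
by apply: (solenoid_hom_torsion_free sS ce b0) => y; rewrite eab a0 mulr0z.
Qed.

Lemma nearly_iso_top_iso_r K L L' : nearly_iso K L -> top_iso L L' ->
  nearly_iso K L'.
Proof.
move=> KL [f [g [cf [cg [fK gK]]]]] p /KL[phi [psi [n [cphi [cpsi [pn [e1 e2]]]]]]].
exists (fun x => f (phi x)), (fun y => psi (g y)), n.
split; first exact: chom_comp.
split; first exact: chom_comp.
by split=> //; split=> x; rewrite ?e1 ?(chomMz _ _ cf) ?gK// fK e2.
Qed.

Lemma nearly_iso_sym K L : nearly_iso K L -> nearly_iso L K.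
Proof.
move=> KL p /KL[phi [psi [n [cphi [cpsi [pn [e1 e2]]]]]]].
by exists psi, phi, n.
Qed.

Lemma top_iso_nearly_iso K L : top_iso K L -> nearly_iso K L.
Proof.
move=> [f [g [cf [cg [fK gK]]]]] p _; exists f, g, 1; split=> //; split=> //.
by split; [exact: coprimen1|split].
Qed.

Lemma nearly_iso_factor S L K p : nearly_iso (tprod S L) K -> prime p ->
  exists2 n : int, coprime p `|n|%N & factors_through S K n.
Proof.
move=> SK /SK[phi [psi [n [cphi [cpsi [pn [_ e]]]]]]]; exists n => //.
exists (fun x => phi (x, 0)), (fun y => (psi y).1); split.
- exact: chom_comp (chom_inl _ _) cphi.
- exact: chom_comp cpsi (chom_fst _ _).
- by move=> x; rewrite e pair_mulrz_prod.
Qed.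

(** The isomorphism between the solenoid parts is stated over an arbitrary tail [U]; this keeps it
    independent of [K] and lets a trivial [U] be inserted at the end. *)
Lemma nearly_iso_prod_list l l' K K' : solenoid_list l -> solenoid_list l' ->
  clipped K -> clipped K' -> nearly_iso (prod_list K l) (prod_list K' l') ->
  (forall U, top_iso (prod_list U l) (prod_list U l')) /\ nearly_iso K K'.
Proof.
move=> + + cK cK'; elim: l l' => [|S l IH] l' sl sl' KK'.
  case: l' sl' KK' => [_ KK'|S' l' [sS' _] KK'].
    by split=> // U; exact: top_iso_refl.
  (* A leftover solenoid on the right would be isomorphic to a member of the empty list. *)
  have [|l1 [S'' [l2 [E _]]]] := @factor_in_list S' [::] K sS' I cK.
    by move=> p; exact: nearly_iso_factor (nearly_iso_sym KK').
  by case: l1 E.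
have [sS {}sl] := sl.
have [|l1 [S' [l2 [l'E iso]]]] := @factor_in_list S l' K' sS sl' cK'.
  by move=> p; exact: nearly_iso_factor KK'.
have moveE U : top_iso (prod_list U l') (tprod S (prod_list U (l1 ++ l2))).
  rewrite l'E; apply: top_iso_trans (prod_list_move _ _ _ _) _.
  by apply: top_iso_prodl; exact: top_iso_sym.
have SS := nearly_iso_top_iso_r KK' (moveE K').
have [|||isoU near] := IH (l1 ++ l2) _ _ _.
- exact: sl.
- move: sl'; rewrite l'E => /solenoid_list_cat[s1 [_ s2]].
  exact/solenoid_list_cat.
- by move=> p pp; exact: (@cancel_solenoid p S _ _ sS pp (SS p pp)).
split=> // U; apply: top_iso_trans (top_iso_sym (moveE U)).
exact: (top_iso_prodr S (isoU U)).
Qed.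

End Factorization.

(** * Splitting off finitely many factors *)

Section Biproduct.
Context (T : topologicalZmodType) (I : eqType) (S : I -> topologicalZmodType).
Context (inj : forall i, S i -> T) (proj : forall i, T -> S i).
Context (cinj : forall i, is_chom (@inj i)) (cproj : forall i, is_chom (proj i)).
Context (injK : forall i x, proj i (@inj i x) = x).
Context (inj0 : forall i j x, i != j -> proj j (@inj i x) = 0).

(** The composite [g f] is a partial sum of projectors, hence the identity once [s] exhausts the
    index set. The last two clauses, orthogonality to indices outside [s], are what the induction
    needs. *)
Lemma biproduct_maps X (s : seq I) : uniq s ->
  exists (f : tprod T X -> prod_list X (map S s))
         (g : prod_list X (map S s) -> tprod T X),
    [/\ is_chom f, is_chom g, cancel g f,
        forall z, g (f z) = (\sum_(i <- s) @inj i (proj i z.1), z.2) &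
        (forall j w, j \notin s -> proj j (g w).1 = 0) /\
        (forall i x, i \notin s -> f (@inj i x, 0) = 0)].
Proof.
elim: s => [_|i s IH /= /andP[is_ /IH[f [g [cf cg gK fK [g0 f0]]]]]].
  exists snd, (fun x => (0, x)); split=> //.
  - exact: chom_snd.
  - exact: chom_inr.
  - by move=> z; rewrite big_nil.
  - by split=> // j w _; rewrite /= (chom0 (cproj j)).
exists (fun z => (proj i z.1, f z)).
exists (fun w => (@inj i w.1 + (g w.2).1, (g w.2).2)); split.
- apply: (@chom_pair _ (S i) (prod_list X (map S s)) (fun z => proj i z.1) f) => //.
  exact: chom_comp (chom_fst _ _) (cproj i).
- apply: (@chom_pair _ T X (fun w => @inj i w.1 + (g w.2).1) (fun w => (g w.2).2)).
    apply: chom_add; first exact: chom_comp (chom_fst _ _) (cinj i).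
    exact: chom_comp (chom_comp (chom_snd _ _) cg) (chom_fst _ _).
  exact: chom_comp (chom_comp (chom_snd _ _) cg) (chom_snd _ _).
- move=> [x w] /=; congr (_, _).
    by rewrite (chomD (cproj i)) injK g0// addr0.
  have -> : (@inj i x + (g w).1, (g w).2) = (@inj i x, 0) + g w :> tprod T X.
    by rewrite [g w in RHS]surjective_pairing; congr (_, _); rewrite ?add0r.
  by rewrite (chomD cf) f0// add0r gK.
- move=> z /=; rewrite fK /= big_cons; congr (_, _).
- split=> [j w|j x]; rewrite inE negb_or => /andP[ji js] /=.
    by rewrite (chomD (cproj j)) g0// addr0 inj0// eq_sym.
  by rewrite f0// inj0.
Qed.

Lemma biproduct_top_iso X (s : seq I) : uniq s ->
  (forall x, \sum_(i <- s) @inj i (proj i x) = x) ->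
  top_iso (tprod T X) (prod_list X (map S s)).
Proof.
move=> us sumE; have [f [g [cf cg gK fK _]]] := biproduct_maps X us.
exists f, g; split=> //; split=> //; split=> // z.
by rewrite fK sumE; case: z.
Qed.

End Biproduct.

(** * Finiteness of the family of solenoids *)

Section TotallyFactored.
Local Notation R := Rdefinitions.R.

(** Linear dependence of [n.+1] vectors in dimension [n]: the matrix of their coordinates has a
    nonzero left kernel. *)
Lemma one_parameter_dependent (G : topologicalZmodType) n
    (gamma : 'I_n.+1 -> R^o -> G) : dim_eq G n ->
  (forall j, is_chom (gamma j)) ->
  exists2 a : 'I_n.+1 -> R, (exists j, a j != 0) &
    forall t, \sum_j gamma j (a j * t) = 0.
Proof.
move=> [b [cb bP]] cgamma.
have /choice[c cE] : forall j, exists c : 'I_n -> R,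
    gamma j = fun t => \sum_(i < n) b i (c i * t).
  by move=> j; have [c [-> _]] := bP _ (cgamma j); exists c.
pose C : 'M[R]_(n.+1, n) := \matrix_(j, i) c j i.
have kC : kermx C != 0.
  rewrite -mxrank_eq0 mxrank_ker -lt0n subn_gt0.
  by rewrite ltnS rank_leq_col.
have /rowV0Pn[v vC v0] := kC.
exists (fun j => v 0 j).
  apply: contrapT => /forallNP H; move/eqP: v0; apply; apply/rowP => j.
  by rewrite mxE; apply/eqP; apply: contrapT => /negP; exact: H.
move=> t; under eq_bigr do rewrite cE.
rewrite exchange_big /= big1// => i _.
have sumb (r : seq 'I_n.+1) (h : 'I_n.+1 -> R^o) :
    \sum_(j <- r) b i (h j) = b i (\sum_(j <- r) h j).
  elim: r => [|j r IH]; first by rewrite !big_nil (chom0 (cb i)).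
  by rewrite !big_cons IH (chomD (cb i)).
rewrite sumb; have /sub_kermxP/rowP/(_ i) := vC; rewrite !mxE => e.
have -> : \sum_(j <- index_enum 'I_n.+1) (c j i * (v 0 j * t) : R^o) = 0.
  transitivity ((\sum_j v 0 j * C j i) * t); last by rewrite e mul0r.
  by rewrite mulr_suml; apply: eq_bigr => j _; rewrite mxE mulrCA mulrA.
exact: chom0.
Qed.

(** Each factor carries a nonzero one-parameter subgroup, and those of distinct factors are
    independent in [G]; so their number is bounded by the dimension. *)
Lemma totally_factored_list (G T K : topologicalZmodType) :
  finite_dimensional G -> top_iso G (tprod T K) -> totally_factored T ->
  exists l, solenoid_list l /\ forall X, top_iso (tprod T X) (prod_list X l).
Proof.
move=> [n dG] [F [F' [cF [cF' [FK F'K]]]]] [_ [I0 [S0 [sS [f [g [fD [cf [cg [fK gK]]]]]]]]]].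
(* The index set is an arbitrary type; classical decidable equality is put on it so that [dfwith]
   and [uniq] apply. *)
pose I : eqType := {classic I0}; pose S : I -> topologicalZmodType := S0.
pose inj (i : I) (x : S i) : T := g (dfwith (fun j : I => 0 : S j) i x).
pose proj (i : I) (x : T) : S i := f x i.
have injK i x : proj i (inj i x) = x by rewrite /proj /inj gK dfwithin.
have inj0 i j x : i != j -> proj j (inj i x) = 0.
  by move=> ij; rewrite /proj /inj gK dfwithout.
have proj_ext x y : (forall i, proj i x = proj i y) -> x = y.
  move=> xy; rewrite -(fK x) -(fK y); congr g.
  by apply: functional_extensionality_dep => i; exact: xy.
have cproj i : is_chom (proj i).
  split=> [x y|x]; first exact: fD.
  apply: (@continuous_comp _ _ _ f (fun h => h i)); first exact: cf.
  exact: (@proj_continuous I (fun i => S i : topologicalType) i).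
have cinj i : is_chom (inj i).
  split=> [x y|x].
    apply: proj_ext => j; rewrite (chomD (cproj j)).
    have [<-|ij] := eqVneq i j; first by rewrite !injK.
    by rewrite !inj0// addr0.
  apply: (@continuous_comp (S i) (prod_topology (fun i => S0 i : topologicalType)) T
    (dfwith (fun j : I => 0 : S j) i) g); last exact: cg.
  exact: (@dfwith_continuous I (fun i => S i : topologicalType)).
have bounded_size (s : seq I) : uniq s -> size s != n.+1.
  move=> us; apply/eqP => sz.
  have i0 : I by case: s sz {us}.
  pose k (j : 'I_n.+1) : I := nth i0 s j.
  pose P j x := proj (k j) (F x).1.
  have cP j : is_chom (P j).
    by apply: chom_comp _ (cproj _); exact: chom_comp cF (chom_fst _ _).
  have /choice[gamma gammaP] : forall j : 'I_n.+1, exists h : R^o -> G,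
      [/\ is_chom h, exists t, P j (h t) != 0 &
          forall i u, i != j -> P i (h u) = 0].
    move=> j; have [b cb [t bt]] := solenoid_one_parameter (sS (k j)).
    exists (fun u => F' (inj (k j) (b u), 0)); split.
    - apply: chom_comp cF'; apply: chom_comp (chom_inl _ _).
      exact: chom_comp cb (cinj (k j)).
    - by exists t; rewrite /P F'K /= injK.
    - by move=> i u ij; rewrite /P F'K inj0// eq_sym nth_uniq ?sz.
  have cgamma j : is_chom (gamma j) by case: (gammaP j).
  have [a [j aj] a0] := one_parameter_dependent dG cgamma.
  have [_ [t /eqP Pt] _] := gammaP j; apply: Pt.
  (* The projection to factor [j] kills every other term, and the argument is rescaled so that the
     surviving one is [gamma j t]. *)
  have : P j (\sum_i gamma i (a i * ((a j)^-1 * t))) = 0 by rewrite a0 (chom0 (cP j)).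
  have sumP (r : seq 'I_n.+1) (h : 'I_n.+1 -> G) :
      P j (\sum_(i <- r) h i) = \sum_(i <- r) P j (h i).
    elim: r => [|i r IH]; first by rewrite !big_nil (chom0 (cP j)).
    by rewrite !big_cons (chomD (cP j)) IH.
  rewrite sumP (bigD1 j)//= big1 => [|i ij].
    by rewrite addr0 mulVKf.
  by case: (gammaP i) => _ _; apply; rewrite eq_sym.
have [s [us scov]] : exists s : seq I, uniq s /\ forall i, i \in s.
  apply: contrapT => H.
  have [s [us sz]] : exists s : seq I, uniq s /\ size s = n.+1.
    elim: n.+1 => [|m [s [us sz]]]; first by exists [::].
    have /existsNP[i /negP is_] : ~ forall i, i \in s.
      by move=> scov; apply: H; exists s.
    by exists (i :: s); rewrite /= is_ us sz.
  by move: (bounded_size s us); rewrite sz eqxx.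
exists (map S s); split.
  by elim: (s) => //= i s' IH; split=> //; exact: sS.
move=> X; apply: (biproduct_top_iso cinj cproj injK inj0) => // x.
apply: proj_ext => j.
have -> : proj j (\sum_(i <- s) inj i (proj i x)) = \sum_(i <- s) proj j (inj i (proj i x)).
  elim: (s) => [|i s' IH]; first by rewrite !big_nil (chom0 (cproj j)).
  by rewrite !big_cons (chomD (cproj j)) IH.
rewrite (bigD1_seq j)//= injK big1_seq ?addr0// => i /andP[ij _].
exact: inj0.
Qed.

End TotallyFactored.

Theorem theorem5p5 (G T K T' K' : topologicalZmodType) :
  connected_compact_group G -> finite_dimensional G ->
  totally_factored T -> clipped K ->
  totally_factored T' -> clipped K' ->
  top_iso G (T * K)%type -> top_iso G (T' * K')%type ->
  top_iso T T' /\ nearly_iso K K'.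
Proof.
move=> _ dG tT cK tT' cK' GTK GTK'.
have [l [sl lE]] := totally_factored_list dG (GTK : top_iso G (tprod T K)) tT.
have [l' [sl' lE']] := totally_factored_list dG (GTK' : top_iso G (tprod T' K')) tT'.
have KK : top_iso (prod_list K l) (prod_list K' l').
  apply: top_iso_trans (top_iso_sym (lE K)) _.
  apply: top_iso_trans (top_iso_sym GTK) _.
  exact: top_iso_trans GTK' (lE' K').
have [isoU near] := nearly_iso_prod_list sl sl' cK cK' (top_iso_nearly_iso KK).
split=> //.
(* A trivial group, realized as the kernel of an identity map, to serve as the tail of both
   products. *)
pose U : topologicalZmodType := kernel (chom_id T).
have U0 (u : U) : u = 0 by apply: kernel_ext; exact: (svalP u).
have unitE (A : topologicalZmodType) : top_iso A (tprod A U).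
  exists (fun x => (x, 0)), fst; split; first exact: chom_inl.
  by split; [exact: chom_fst|split=> // -[x u]; rewrite (U0 u)].
apply: top_iso_trans (unitE T) _; apply: top_iso_trans (lE U) _.
apply: top_iso_trans (isoU U) _; apply: top_iso_trans (top_iso_sym (lE' U)) _.
exact: top_iso_sym (unitE T').
Qed.
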